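(* Let $\Phi=\{\phi_1,\dots,\phi_n\}\subset L^\infty(X)$ have synthesis operator $\mathcal T$ with singular value decomposition $\mathcal T=\sum_{i=1}^{\hat n}\sigma_iu_iv_i^*$, and for $\epsilon>0$ let $$k^\epsilon(x)=\sum_{i=1}^{\hat n}\frac{\sigma_i^2}{\sigma_i^2+\epsilon^2}|u_i(x)|^2,\qquad \hat n^\epsilon=\int_Xk^\epsilon\,d\rho=\sum_{i=1}^{\hat n}\frac{\sigma_i^2}{\sigma_i^2+\epsilon^2}.$$ Let $0<\delta<1$, let $\|\mathcal T\|_{2,L^2_\rho}\ge\epsilon>0$, and let the sampling operator be the random pointwise sampling operator $$\mathcal M:f\mapsto\{\sqrt{w_j}\,f(x_j)\}_{j=1}^m,\qquad x_j\overset{\mathrm{iid}}{\sim}\mu,\quad w_j=w(x_j)/m,\quad\text{where } w\,d\mu=d\rho .$$ If $$m\ge\left(9.34\,\|wk^\epsilon\|_{L^\infty}+1.34\right)\log(8\hat n^\epsilon/\delta),$$ then, with probability at least $1-\delta$, $$\frac12\left(\|\mathcal Tc\|_{L^2_\rho}+\epsilon\|c\|_2\right)\le\|\mathcal M\mathcal Tc\|_2+\epsilon\|c\|_2,\qquad\forall c\in\mathbb C^n.$$ In particular, for $w=\hat n^\epsilon/k^\epsilon$, the condition on $m$ becomes $$m\ge\left(9.34\,\hat n^\epsilon+1.34\right)\log(8\hat n^\epsilon/\delta).$$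
   Context: $X\subseteq\mathbb R^d$ is measurable, $\rho$ is a non-atomic probability measure on $X$, and $\|\cdot\|_{L^2_\rho}$ is the norm of the complex space $L^2(X,\rho)$. $\mathcal T:\mathbb C^n\to L^2(X,\rho)$, $\mathcal Tc=\sum_{i=1}^nc_i\phi_i$, and $\|\mathcal T\|_{2,L^2_\rho}=\sup_{c\ne0}\|\mathcal Tc\|_{L^2_\rho}/\|c\|_2$. $\Phi$ need not be linearly independent; $\hat n=\dim\mathrm{span}(\Phi)$. In the singular value decomposition, $\sigma_1\ge\dots\ge\sigma_{\hat n}>0$, $\{u_i\}_{i=1}^{\hat n}$ is an orthonormal basis of $\mathrm{span}(\Phi)$ in $L^2(X,\rho)$, and $\{v_i\}_{i=1}^{\hat n}$ is orthonormal in $\mathbb C^n$. The weight $w$ is positive ($\rho$-a.e.) with $\|w^{-1}\|_{L^1_\rho}=1$, so that $d\mu=w^{-1}d\rho$ is a probability measure. It is assumed that $k^\epsilon>0$ almost everywhere. $\log$ is the natural logarithm. *)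

(* Defs.v *)
From HB Require Import structures.
From mathcomp Require Import all_boot all_order all_algebra.
From mathcomp Require Import all_classical all_reals all_analysis.
From mathcomp Require Import complex.

Set Implicit Arguments.
Unset Strict Implicit.
Unset Printing Implicit Defensive.

Import Order.TTheory GRing.Theory Num.Theory.
Import numFieldNormedType.Exports.

Local Open Scope classical_set_scope.
Local Open Scope ring_scope.

(* A measure on a measurable set X is given by a measure rho on the ambient
   space with full mass on X.  Functions on X are functions on the ambient space
   of which only the values on X matter. *)

Section norms.
Context {R : realType}.
Implicit Type z : R[i].

(* The modulus as a real number; `|z| would live in R[i]. *)
Definition cabs z : R := Normc.normc z.

Definition l2norm k (c : 'cV[R[i]]_k) : R :=
  Num.sqrt (\sum_(i < k) cabs (c i ord0) ^+ 2).

Definition cdot k (a b : 'cV[R[i]]_k) : R[i] :=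
  \sum_(i < k) a i ord0 * conjc (b i ord0).

End norms.

Section spaces.
Context {disp : measure_display} {T : measurableType disp} {R : realType}.
Variables (X : set T) (rho : {measure set T -> \bar R}).

Definition ae_on (P : T -> Prop) : Prop := {ae rho, forall x, X x -> P x}.

(* Every measurable set of positive measure can be split nontrivially. *)
Definition nonatomic : Prop :=
  forall A : set T, measurable A -> (0 < rho A)%E ->
    exists B : set T, [/\ measurable B, B `<=` A & (0 < rho B < rho A)%E].

(* Extended-real L^p(X, rho) norm, p : \bar R. *)
Definition Lpnorm (p : \bar R) (g : T -> R) : \bar R :=
  'N[rho]_p[(EFin \o g) \_ X]%E.

Definition cmeasurable (f : T -> R[i]) : Prop :=
  measurable_fun X (fun x => complex.Re (f x)) /\
  measurable_fun X (fun x => complex.Im (f x)).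

Definition in_Linfty (f : T -> R[i]) : Prop :=
  cmeasurable f /\ (Lpnorm +oo (cabs \o f) < +oo)%E.

Definition in_L2 (f : T -> R[i]) : Prop :=
  cmeasurable f /\ (Lpnorm 2%:E (cabs \o f) < +oo)%E.

(* Real-valued; only meaningful for functions in L^2. *)
Definition L2norm (f : T -> R[i]) : R := fine (Lpnorm 2%:E (cabs \o f)).

Definition L2dot (f g : T -> R[i]) : R[i] :=
  Complex (\int[rho]_(x in X) complex.Re (f x * conjc (g x)))
          (\int[rho]_(x in X) complex.Im (f x * conjc (g x))).

Section dictionary.
Variables (n : nat) (phi : 'I_n -> T -> R[i]).

Definition synth (c : 'cV[R[i]]_n) : T -> R[i] :=
  fun x => \sum_(i < n) c i ord0 * phi i x.

(* Extended-real; the supremum is -oo when n = 0. *)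
Definition opnorm : \bar R :=
  ereal_sup [set (L2norm (synth c) / l2norm c)%:E | c in [set c | c != 0]].

(* Elements of L^2 are classes modulo rho-a.e. equality, hence membership in the
   span is up to rho-a.e. equality. *)
Definition in_span (f : T -> R[i]) : Prop :=
  exists c : 'cV[R[i]]_n, ae_on (fun x => f x = synth c x).

Definition onb_of_span k (u : 'I_k -> T -> R[i]) : Prop :=
  [/\ forall i, in_L2 (u i) /\ in_span (u i),
      forall i j, L2dot (u i) (u j) = (i == j)%:R
    & forall f, in_span f -> exists a : 'I_k -> R[i],
        ae_on (fun x => f x = \sum_(i < k) a i * u i x)].

(* synth = \sum_i sigma_i u_i v_i^*, with k = dim span(phi) forced by the
   second clause. *)
Definition is_svd k (sigma : 'I_k -> R) (u : 'I_k -> T -> R[i])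
    (v : 'I_k -> 'cV[R[i]]_n) : Prop :=
  [/\ (forall i, 0 < sigma i) /\
      (forall i j : 'I_k, (i <= j)%N -> sigma j <= sigma i),
      onb_of_span u,
      forall i j, cdot (v i) (v j) = (i == j)%:R
    & forall c, ae_on (fun x =>
        synth c x = \sum_(i < k) (sigma i)%:C%C * cdot c (v i) * u i x)].

End dictionary.

Definition k_eps k (sigma : 'I_k -> R) (u : 'I_k -> T -> R[i]) (eps : R) :
    T -> R :=
  fun x => \sum_(i < k)
    sigma i ^+ 2 / (sigma i ^+ 2 + eps ^+ 2) * cabs (u i x) ^+ 2.

Definition n_eps k (sigma : 'I_k -> R) (u : 'I_k -> T -> R[i]) (eps : R) : R :=
  \int[rho]_(x in X) k_eps sigma u eps x.

Definition is_weight (w : T -> R) : Prop :=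
  [/\ measurable_fun X w, ae_on (fun x => 0 < w x)
    & Lpnorm 1%:E (fun x => (w x)^-1) = 1%E].

(* d mu = w^-1 d rho on X. *)
Definition sampling_measure (w : T -> R) (A : set T) : \bar R :=
  (\int[rho]_(x in A `&` X) ((w x)^-1)%:E)%E.

Definition sampling_op (w : T -> R) m (x : 'I_m -> T) (f : T -> R[i]) :
    'cV[R[i]]_m :=
  \col_j ((Num.sqrt (w (x j) / m%:R))%:C%C * f (x j)).

Section random_samples.
Context {dispO : measure_display} {Omega : measurableType dispO}.
Variable P : probability Omega R.

Definition mutually_independent m (x : 'I_m -> {RV P >-> T}) : Prop :=
  forall (J : {set 'I_m}) (A : 'I_m -> set T),
    (forall j, measurable (A j)) ->
    P (\bigcap_(j in [set` J]) (x j @^-1` A j)) =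
    (\prod_(j in J) P (x j @^-1` A j))%E.

(* X-valued iid samples from the sampling measure of w. *)
Definition iid_samples (w : T -> R) m (x : 'I_m -> {RV P >-> T}) : Prop :=
  [/\ forall j om, X (x j om),
      forall j A, measurable A -> distribution P (x j) A = sampling_measure w A
    & mutually_independent x].

Definition stability_event n (phi : 'I_n -> T -> R[i]) (eps : R) (w : T -> R) m
    (x : 'I_m -> {RV P >-> T}) : set Omega :=
  [set om | forall c : 'cV[R[i]]_n,
    1 / 2 * (L2norm (synth phi c) + eps * l2norm c) <=
    l2norm (sampling_op w (fun j => x j om) (synth phi c)) + eps * l2norm c].

End random_samples.

Definition stable_whp n (phi : 'I_n -> T -> R[i]) (eps delta : R) (w : T -> R)
    (m : nat) : Prop :=
  forall (dispO : measure_display) (Omega : measurableType dispO)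
    (P : probability Omega R) (x : 'I_m -> {RV P >-> T}),
    iid_samples w x ->
    measurable (stability_event phi eps w x) /\
    (P (stability_event phi eps w x) >= (1 - delta)%:E)%E.

End spaces.

(* Main.v *)
Require Import Defs.
From HB Require Import structures.
From mathcomp Require Import all_boot all_order all_algebra.
From mathcomp Require Import ring lra.
From mathcomp Require Import all_classical all_reals all_analysis.
From mathcomp Require Import measurable_realfun ess_sup_inf.
From mathcomp Require Import complex.
Import Order.TTheory GRing.Theory Num.Theory.
Import numFieldNormedType.Exports.
Local Open Scope classical_set_scope.
Local Open Scope ring_scope.
Set Implicit Arguments.
Unset Strict Implicit.
Unset Printing Implicit Defensive.

(** The singular value decomposition turns the claim into a lower bound on a
    random positive matrix.  Put [d_i = sigma_i^2 / (sigma_i^2 + eps^2)] and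
    [y_i = sqrt (sigma_i^2 + eps^2) <c, v_i>], and let [A(x)] be [w(x)] times the
    rank-one Hermitian matrix whose form at [y] is
    [|sum_i sqrt d_i y_i u_i(x)|^2].  Then [|M T c|^2] is the form of
    [m^-1 (A(x_1) + ... + A(x_m))] at [y], while [|T c|^2] is the form of its mean
    [D = diag d], and [|y|^2 <= |T c|^2 + eps^2 |c|^2] by Bessel's inequality
    ([bessel]).  As soon as the random form is at least the form of [D - 1/2], the
    stability estimate follows by an elementary computation ([half_sum_le]).

    The lower tail of the sum is controlled by a matrix Bernstein inequality
    ([matrix_bernstein_lower]) in which the dimension is replaced by the
    intrinsic dimension, the trace of [D].  Let [Y = s (D - A(x))] and let [S_j]
    be the sum of the first [j] copies of [Y].  The potential
    [E tr (exp S_j - 1 - S_j)] starts at [0].  By the Golden-Thompson inequality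
    and the independence of [x_j] and [S_j], one step replaces [E tr exp S_j] by
    at most [E tr (exp S_j E exp Y)], and [E exp Y <= 1 + kappa D].  Since [S_j] is
    centered, [E tr (exp S_j D)] is at most [tr D] plus the potential, so that
    the potential [h] obeys [h_(j+1) <= (1 + kappa) h_j + kappa tr D]
    ([potential_step]) and only [tr D] enters the final bound.  Markov's
    inequality ([bernstein_tail]) concludes, since an eigenvalue of [S_m] above
    [tau] makes the trace at least [exp tau - 1 - tau].

    The exponential is replaced throughout by [(1 + H / p)^p] with [p] a large
    power of two, which makes all matrix facts polynomial identities and
    inequalities.  Positivity of remainders needs no diagonalisation
    ([psd_remainder], [psd_remainder_le]); for dyadic [p] the inequality
    [tr (P Q)^p <= tr (P^p Q^p)] follows from Cauchy-Schwarz by induction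
    ([lieb_thirring]), and replacing [1 + (A + B) / p] by the product
    [(1 + A / p) (1 + B / p)] costs only [O(1 / p)]
    ([golden_thompson_pow2]).  The constants leave room for this error.

    Complex vectors are written in real coordinates, which doubles the trace of
    [D]: the term [ln (4 tr D / delta)] of the Bernstein inequality becomes
    [ln (8 n_eps / delta)].  The hypothesis on [eps] gives [eps <= sigma_1], hence
    [n_eps >= 1 / 2] and a positive logarithm.  The stability event is measurable
    because rational vectors [c] are enough to test it. *)

(** * Quadratic forms and positive matrices *)

Section psd.
Context {R : realFieldType} {q : nat}.
Implicit Types (A B C P Q X Z : 'M[R]_q) (y : 'rV[R]_q) (c : R).

Definition qform A y : R := (y *m A *m y^T) 0 0.

(** Positivity of the form alone, without symmetry, so that it passes to sums
    and congruences with no side condition. *)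
Definition psd A := forall y, 0 <= qform A y.

Definition sym A := A^T = A.

Lemma qformE A y : qform A y = \sum_i \sum_j y 0 i * A i j * y 0 j.
Proof.
rewrite /qform mxE exchange_big/=; apply: eq_bigr => j _.
by rewrite !mxE mulr_suml; apply: eq_bigr => i _.
Qed.

Lemma qform1E y : qform 1 y = \sum_i y 0 i ^+ 2.
Proof.
by rewrite /qform mulmx1 mxE; apply: eq_bigr => i _; rewrite mxE expr2.
Qed.

Lemma qform1_ge0 y : 0 <= qform 1 y.
Proof. by rewrite qform1E; apply: sumr_ge0 => i _; rewrite sqr_ge0. Qed.

Lemma qformD A B y : qform (A + B) y = qform A y + qform B y.
Proof. by rewrite /qform mulmxDr mulmxDl mxE. Qed.

Lemma qformN A y : qform (- A) y = - qform A y.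
Proof. by rewrite /qform mulmxN mulNmx mxE. Qed.

Lemma qformB A B y : qform (A - B) y = qform A y - qform B y.
Proof. by rewrite qformD qformN. Qed.

Lemma qformZ c A y : qform (c *: A) y = c * qform A y.
Proof. by rewrite /qform -scalemxAr -scalemxAl mxE. Qed.

Lemma qform0 y : qform 0 y = 0.
Proof. by rewrite /qform mulmx0 mul0mx mxE. Qed.

Lemma qform_sum I (r : seq I) (F : I -> 'M[R]_q) y :
  qform (\sum_(i <- r) F i) y = \sum_(i <- r) qform (F i) y.
Proof.
by elim/big_rec2: _ => [|i a b _ <-]; rewrite ?qform0 // qformD.
Qed.

Lemma qform_congr A C y : qform (C * A * C^T) y = qform A (y *m C).
Proof. by rewrite /qform trmx_mul !mulmxA. Qed.

Lemma psdD A B : psd A -> psd B -> psd (A + B).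
Proof. by move=> pA pB y; rewrite qformD addr_ge0. Qed.

Lemma psdZ c A : 0 <= c -> psd A -> psd (c *: A).
Proof. by move=> c0 pA y; rewrite qformZ mulr_ge0. Qed.

Lemma psd_sum I (r : seq I) (F : I -> 'M[R]_q) :
  (forall i, psd (F i)) -> psd (\sum_(i <- r) F i).
Proof. by move=> pF y; rewrite qform_sum sumr_ge0 // => i _; exact: pF. Qed.

Lemma psd1 : psd 1. Proof. exact: qform1_ge0. Qed.

Lemma psd_congr A C : psd A -> psd (C * A * C^T).
Proof. by move=> pA y; rewrite qform_congr. Qed.

Lemma psd_congr_sym A C : sym C -> psd A -> psd (C * A * C).
Proof. by move=> sC /(@psd_congr _ C); rewrite sC. Qed.

Lemma psd_mul_tr C : psd (C * C^T).
Proof. by have := psd_congr C psd1; rewrite mulr1. Qed.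

Lemma symX A i : sym A -> sym (A ^+ i).
Proof.
move=> sA; elim: i => [|i IH]; first by rewrite /sym expr0 trmx1.
by rewrite /sym exprSr trmx_mul IH sA -[_ *m _]/(_ * _) -exprS -exprSr.
Qed.

Lemma symD A B : sym A -> sym B -> sym (A + B).
Proof. by move=> sA sB; rewrite /sym linearD/= sA sB. Qed.

Lemma symZ c A : sym A -> sym (c *: A).
Proof. by move=> sA; rewrite /sym linearZ/= sA. Qed.

Lemma sym1 : sym 1. Proof. exact: trmx1. Qed.

Lemma sym_diag (d : 'rV[R]_q) : sym (diag_mx d).
Proof. exact: tr_diag_mx. Qed.

Lemma sym_sum I (r : seq I) (Q' : pred I) (F : I -> 'M[R]_q) :
  (forall i, sym (F i)) -> sym (\sum_(i <- r | Q' i) F i).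
Proof.
move=> sF; elim/big_ind: _ => //; [by rewrite /sym trmx0|exact: symD].
Qed.

Lemma qform_delta A i : qform A (delta_mx 0 i) = A i i.
Proof.
by rewrite /qform -rowE trmx_delta -colE !mxE.
Qed.

Lemma psd_diag_ge0 A i : psd A -> 0 <= A i i.
Proof. by move=> /(_ (delta_mx 0 i)); rewrite qform_delta. Qed.

Lemma psd_tr_ge0 A : psd A -> 0 <= \tr A.
Proof. by move=> pA; apply: sumr_ge0 => i _; exact: psd_diag_ge0. Qed.

(** Summing the form over the vectors [y_j e_i - y_i e_j] gives twice the
    difference of the two sides, so no spectral decomposition is needed. *)
Lemma psd_le_tr A y : psd A -> qform A y <= \tr A * qform 1 y.
Proof.
move=> pA.
pose z i j : 'rV[R]_q := y 0 j *: delta_mx 0 i - y 0 i *: delta_mx 0 j.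
have zE i j : qform A (z i j) = A i i * y 0 j ^+ 2 + A j j * y 0 i ^+ 2
    - y 0 i * A i j * y 0 j - y 0 j * A j i * y 0 i.
  have e a b :
    ((delta_mx 0 a : 'rV[R]_q) *m A *m (delta_mx 0 b : 'rV[R]_q)^T) 0 0 = A a b.
    by rewrite -rowE trmx_delta -colE !mxE.
  rewrite /qform /z [trmx _]linearB/= 2![trmx _]linearZ/= mulmxBl mulmxBr.
  rewrite !mulmxBl -!scalemxAr -!scalemxAl.
  have mD (M N : 'M[R]_1) : (M - N) 0 0 = M 0 0 - N 0 0 by rewrite !mxE.
  have mZ a (M : 'M[R]_1) : (a *: M) 0 0 = a * M 0 0 by rewrite mxE.
  by rewrite !(mD, mZ) !e; ring.
have : 0 <= \sum_i \sum_j qform A (z i j).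
  by apply: sumr_ge0 => i _; apply: sumr_ge0 => j _; exact: pA.
have S1 : \sum_i \sum_j A i i * y 0 j ^+ 2 = \tr A * qform 1 y.
  rewrite /mxtrace mulr_suml; apply: eq_bigr => i _.
  by rewrite qform1E mulr_sumr.
have -> : \sum_i \sum_j qform A (z i j) =
    \tr A * qform 1 y + \tr A * qform 1 y - qform A y - qform A y.
  transitivity (\sum_i (\sum_j A i i * y 0 j ^+ 2 + \sum_j A j j * y 0 i ^+ 2 -
      \sum_j y 0 i * A i j * y 0 j - \sum_j y 0 j * A j i * y 0 i)).
    by apply: eq_bigr => i _; under eq_bigr do rewrite zE;
       rewrite !big_split/= !sumrN.
  rewrite !big_split/= !sumrN S1 -qformE.
  by congr (_ + _ - _ - _); rewrite exchange_big/= ?S1 -?qformE.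
lra.
Qed.

End psd.

(** * Powers of positive matrices *)

Section powers.
Context {R : realFieldType} {q : nat}.
Implicit Types (A B C P Q X Z : 'M[R]_q) (y : 'rV[R]_q) (b c : R).

Local Notation "b %:I" := (b *: (1 : 'M[R]_q)) (at level 2, format "b %:I").

Lemma scaleMl b A B : b *: (A * B) = b *: A * B.
Proof. exact: scalemxAl. Qed.

Lemma scaleMr b A B : b *: (A * B) = A * (b *: B).
Proof. exact: scalemxAr. Qed.

(** Even powers are squares, and odd powers are congruent to the matrix
    itself. *)
Lemma psd_exp B i : sym B -> psd B -> psd (B ^+ i).
Proof.
move=> sB pB; rewrite -(odd_double_half i) -addnn addnA exprD.
have -> : B ^+ (odd i + i./2) = B ^+ i./2 * B ^+ odd i by rewrite -exprD addnC.
apply: psd_congr_sym; first exact: symX.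
by case: (odd i); [rewrite expr1|exact: psd1].
Qed.

(** By congruence with a power of [B] it suffices to treat the exponents 0 and
    1, and [b (b - B) B = (b - B) B (b - B) + B (b - B) B]. *)
Lemma psd_sub_mul_exp b B i : 0 < b -> sym B -> psd B -> psd (b%:I - B) ->
  psd ((b%:I - B) * B ^+ i).
Proof.
move=> b0 sB pB pbB.
have sbB : sym (b%:I - B).
  by apply: symD; [exact/symZ/sym1|rewrite -scaleN1r; exact: symZ].
have cB j : (b%:I - B) * B ^+ j = B ^+ j * (b%:I - B).
  rewrite mulrBl mulrBr -exprS -exprSr; congr (_ - _).
  by rewrite -scaleMl -scaleMr mul1r mulr1.
have pbBB : psd ((b%:I - B) * B).
  have -> : (b%:I - B) * B =
      b^-1 *: ((b%:I - B) * B * (b%:I - B) + B * (b%:I - B) * B).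
    have := cB 1%N; rewrite expr1 => <-.
    rewrite -mulrDr subrK -scaleMr mulr1 scalerA mulVf ?scale1r//.
    by rewrite gt_eqF.
  by apply: psdZ; [rewrite invr_ge0 ltW|apply: psdD; apply: psd_congr_sym].
have p : psd ((b%:I - B) * B ^+ odd i).
  by case: (odd i); rewrite ?expr1// expr0 mulr1.
have -> : (b%:I - B) * B ^+ i =
    B ^+ i./2 * ((b%:I - B) * B ^+ odd i) * B ^+ i./2.
  rewrite mulrA -cB -!mulrA -!exprD addnCA addnn addnC.
  by rewrite -{1}(odd_double_half i) addnC.
exact: psd_congr_sym (symX _ sB) p.
Qed.

Lemma psd_pow_sub b B i : 0 < b -> sym B -> psd B -> psd (b%:I - B) ->
  psd ((b ^+ i)%:I - B ^+ i).
Proof.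
move=> b0 sB pB pbB; elim: i => [|i IH].
  by rewrite !expr0 scale1r subrr => y; rewrite qform0.
have -> : (b ^+ i.+1)%:I - B ^+ i.+1 =
    b *: ((b ^+ i)%:I - B ^+ i) + (b%:I - B) * B ^+ i.
  by rewrite scalerBr scalerA -exprS mulrBl -scaleMl mul1r -exprS addrA subrK.
by apply: psdD; [apply: psdZ => //; exact: ltW|exact: psd_sub_mul_exp].
Qed.

(** At [X = H / p], an approximation of [exp H - 1 - H]. *)
Definition remainder p X := (1 + X) ^+ p - 1 - p%:R *: X.

Lemma remainderS p X :
  remainder p.+1 X = remainder p X + \sum_(i < p) X * (1 + X) ^+ i * X.
Proof.
have -> : \sum_(i < p) X * (1 + X) ^+ i * X = ((1 + X) ^+ p - 1) * X.
  rewrite -mulr_suml; congr (_ * _).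
  by rewrite subrX1 [1 + X - 1]addrAC subrr add0r mulr_sumr.
rewrite /remainder exprSr mulrDr mulr1 mulrBl mul1r.
rewrite -addn1 natrD scalerDl scale1r.
set a := _ ^+ p; set b := a * X; set c := _ *: X.
by rewrite opprD !addrA; congr (_ - _); rewrite -!addrA; congr (_ + _);
  rewrite addrC -!addrA; congr (_ + _); rewrite addrC.
Qed.

Lemma remainder0 X : remainder 0 X = 0.
Proof. by rewrite /remainder expr0 subrr scale0r subr0. Qed.

(** Bernoulli's inequality for matrices: the remainder is a sum of terms
    [X (1 + X)^i X]. *)
Lemma psd_remainder p X : sym X -> psd (1 + X) -> psd (remainder p X).
Proof.
move=> sX pX; elim: p => [|p IH]; first by rewrite remainder0 => y; rewrite qform0.
rewrite remainderS; apply: psdD => //; apply: psd_sum => i.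
by apply: psd_congr_sym => //; apply: psd_exp => //; apply: symD => //; exact: sym1.
Qed.

Definition scalar_remainder p (t : R) := (1 + t) ^+ p - 1 - p%:R * t.

(** The remainder is [X^2] times a polynomial in [1 + X] with nonnegative
    coefficients, and the powers of [1 + X] are dominated by those of [1 + t]. *)
Lemma psd_remainder_le p X (t : R) : sym X -> psd (1 + X) -> 0 < t ->
  psd (t%:I - X) ->
  psd ((scalar_remainder p t / t ^+ 2) *: X ^+ 2 - remainder p X).
Proof.
move=> sX pX t0 ptX.
have t20 : t ^+ 2 != 0 by rewrite expf_neq0// gt_eqF.
elim: p => [|p IH].
  rewrite remainder0 /scalar_remainder expr0 !(subrr, mulr0n, mul0r, subr0, scale0r).
  by move=> y; rewrite qform0.
have -> : scalar_remainder p.+1 t =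
    scalar_remainder p t + \sum_(i < p) (1 + t) ^+ i * t ^+ 2.
  rewrite /scalar_remainder -mulr_suml expr2 mulrA.
  have -> : (\sum_(i < p) (1 + t) ^+ i) * t = (1 + t) ^+ p - 1.
    by rewrite subrX1 addrAC subrr add0r mulrC.
  by rewrite exprS -natr1; ring.
rewrite mulrDl -mulr_suml mulfK// scalerDl remainderS opprD addrACA.
apply: psdD => //.
rewrite scaler_suml -sumrB; apply: psd_sum => i.
have -> : (1 + t) ^+ i *: X ^+ 2 - X * (1 + X) ^+ i * X =
    X * (((1 + t) ^+ i)%:I - (1 + X) ^+ i) * X.
  by rewrite mulrBr mulrBl -scaleMr mulr1 -scaleMl expr2.
apply: psd_congr_sym => //; apply: psd_pow_sub => //.
- by rewrite addr_gt0.
- by apply: symD => //; exact: sym1.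
- by rewrite scalerDl scale1r opprD addrACA subrr add0r.
Qed.

(** Cauchy-Schwarz for [y B] and [y], in the normalisation [|y| = 1]. *)
Lemma qform_sqr B y : sym B -> qform 1 y = 1 -> qform B y ^+ 2 <= qform (B ^+ 2) y.
Proof.
move=> sB y1.
have : 0 <= qform 1 (y *m (B - (qform B y)%:I)) by exact: qform1_ge0.
rewrite -qform_congr mulr1.
have -> : (B - (qform B y)%:I)^T = B - (qform B y)%:I.
  rewrite -[RHS]/(_ + _) (symD sB)// -scaleN1r; apply/symZ/symZ; exact: sym1.
rewrite mulrBl !mulrBr -!scaleMl -!scaleMr !mul1r !mulr1 scalerA.
by rewrite !qformB !qformZ y1 expr2; lra.
Qed.

(** Jensen's inequality for the convex function [t^(2^k)]. *)
Lemma qform_pow2 B y k : sym B -> psd B -> qform 1 y = 1 ->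
  qform B y ^+ (2 ^ k) <= qform (B ^+ (2 ^ k)) y.
Proof.
move=> sB pB y1; elim: k => [|k IH]; first by rewrite !expr1.
rewrite expnSr !exprM; apply: le_trans (qform_sqr (symX _ sB) y1).
apply: lerXn2r => //; rewrite nnegrE; last exact: psd_exp.
exact/exprn_ge0/pB.
Qed.

Lemma scalar_remainder_homo p (s t : R) : 0 <= s -> s <= t ->
  scalar_remainder p s <= scalar_remainder p t.
Proof.
move=> s0 st; elim: p => [|p IH]; first by rewrite /scalar_remainder !expr0 !mulr0n !mul0r.
have e u : scalar_remainder p.+1 u =
    scalar_remainder p u + ((1 + u) ^+ p - 1) * u.
  by rewrite /scalar_remainder exprS -natr1; ring.
rewrite !e lerD// ler_pM//.
  by rewrite subr_ge0 exprn_ege1// lerDl.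
by rewrite lerD2r lerXn2r// ?nnegrE; lra.
Qed.

End powers.

(** A vector on which the form of [X] exceeds [t >= 0] forces the trace of the
    remainder to be large: Jensen's inequality for the dyadic power, then the
    form of a positive matrix at a unit vector is at most the trace. *)
Lemma scalar_remainder_le_tr (R : rcfType) q k (X : 'M[R]_q) y (t : R) :
  sym X -> psd (1 + X) -> 0 <= t -> 0 < qform 1 y -> t * qform 1 y <= qform X y ->
  scalar_remainder (2 ^ k) t <= \tr (remainder (2 ^ k) X).
Proof.
move=> sX pX t0 y0 tX.
pose z := (Num.sqrt (qform 1 y))^-1 *: y.
have qfz A : qform A z = qform A y / qform 1 y.
  rewrite /qform /z [trmx _]linearZ/= -!(scalemxAl, scalemxAr) scalerA.
  by rewrite -expr2 exprVn sqr_sqrtr ?ltW// mxE mulrC.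
have z1 : qform 1 z = 1 by rewrite qfz divff// gt_eqF.
have tz : t <= qform X z by rewrite qfz ler_pdivlMr.
have s1X : sym (1 + X) by apply: symD => //; exact: sym1.
have := psd_le_tr z (psd_remainder (2 ^ k) sX pX).
rewrite z1 mulr1; apply: le_trans.
apply: le_trans (scalar_remainder_homo _ t0 tz) _.
rewrite /remainder /scalar_remainder !qformB qformZ z1 !lerD2r.
by apply: le_trans (qform_pow2 k s1X pX z1); rewrite qformD z1.
Qed.

(** * Traces of powers of a product, and the row-sum norm *)

Section lieb_thirring.
Context {R : realFieldType} {q : nat}.
Implicit Types (A B C P Q X Z : 'M[R]_q).

Lemma trmxX A i : (A ^+ i)^T = A^T ^+ i.
Proof.
elim: i => [|i IH]; first by rewrite !expr0 trmx1.
by rewrite exprSr trmx_mul IH exprS.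
Qed.

Lemma trmxM A B : (A * B)^T = B^T * A^T. Proof. exact: trmx_mul. Qed.

Lemma mxtraceC A B : \tr (A * B) = \tr (B * A). Proof. exact: mxtrace_mulC. Qed.

Lemma mxtrace_exp_mulC A B i : \tr ((A * B) ^+ i) = \tr ((B * A) ^+ i).
Proof.
case: i => [|i]; first by rewrite !expr0.
have e : (A * B) ^+ i.+1 = A * (B * A) ^+ i * B.
  elim: i => [|i IH]; first by rewrite expr1 expr0 mulr1.
  by rewrite exprS IH exprS !mulrA.
by rewrite e mxtraceC mulrA exprS.
Qed.

Lemma mxtrace_mul_le A B : \tr (A * B) *+ 2 <= \tr (A * A^T) + \tr (B^T * B).
Proof.
have := psd_tr_ge0 (psd_mul_tr (A - B^T)).
rewrite [trmx (_ - _)]linearB/= trmxK mulrBl !mulrBr.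
rewrite !linearB/=.
have -> : \tr (B^T * A^T) = \tr (A * B) by rewrite -trmxM mxtrace_tr.
by rewrite mulr2n; lra.
Qed.

Lemma mxtrace_sqr_le Z : \tr (Z ^+ 2) <= \tr (Z * Z^T).
Proof.
have := mxtrace_mul_le Z Z; rewrite [\tr (Z^T * Z)]mxtraceC -expr2 mulr2n; lra.
Qed.

(** The two inequalities are proved together.  The second one for [Z] follows
    from the second one at the previous rank for [Z ^+ 2], whose right-hand side
    is then split by the first one for the pair [Z Z^T], [Z^T Z].  The first one
    follows from the second one for [P Q], since [(P Q) (P Q)^T] and
    [P^2 Q^2] have the same traces of powers. *)
Lemma lieb_thirring_weyl k :
  (forall P Q, sym P -> sym Q ->
    \tr ((P * Q) ^+ (2 ^ k)) <= \tr (P ^+ (2 ^ k) * Q ^+ (2 ^ k))) /\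
  (forall Z, \tr (Z ^+ (2 ^ k.+1)) <= \tr ((Z * Z^T) ^+ (2 ^ k))).
Proof.
elim: k => [|k [LT W]].
  by split=> [P Q _ _|Z]; rewrite !expr1//; exact: mxtrace_sqr_le.
split=> [P Q sP sQ|Z].
  apply: le_trans (W (P * Q)) _.
  rewrite trmxM sP sQ mulrA -(mulrA P) mxtrace_exp_mulC mulrA -!expr2.
  by apply: le_trans (LT _ _ (symX 2 sP) (symX 2 sQ)) _; rewrite -!exprM -expnS.
have sZ1 : sym (Z^T * Z) by rewrite /sym trmxM trmxK.
have sZ2 : sym (Z * Z^T) by rewrite /sym trmxM trmxK.
rewrite expnS exprM; apply: le_trans (W (Z ^+ 2)) _.
rewrite trmxX !expr2 -mulrA mxtrace_exp_mulC -!mulrA mulrA.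
apply: le_trans (LT _ _ sZ2 sZ1) _.
have := mxtrace_mul_le ((Z * Z^T) ^+ (2 ^ k)) ((Z^T * Z) ^+ (2 ^ k)).
rewrite (symX _ sZ1) (symX _ sZ2) -!exprD addnn -mul2n -expnS.
by rewrite (mxtrace_exp_mulC Z^T) mulr2n; lra.
Qed.

Lemma lieb_thirring k P Q : sym P -> sym Q ->
  \tr ((P * Q) ^+ (2 ^ k)) <= \tr (P ^+ (2 ^ k) * Q ^+ (2 ^ k)).
Proof. exact: (lieb_thirring_weyl k).1. Qed.

End lieb_thirring.

Section row_sum_norm.
Context {R : realFieldType} {q : nat}.
Implicit Types (A B C P Q X Z : 'M[R]_q) (a b c : R).

(** The operator norm for the maximum norm: unlike the sum of the absolute
    values of all entries, it gives the identity matrix norm 1, so that powers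
    of [1 + H / p] stay bounded as [p] grows. *)
Definition row_bound A c := forall i, \sum_j `|A i j| <= c.

Lemma row_boundW A a b : a <= b -> row_bound A a -> row_bound A b.
Proof. by move=> ab rA i; exact: le_trans (rA i) ab. Qed.

Lemma row_boundD A B a b :
  row_bound A a -> row_bound B b -> row_bound (A + B) (a + b).
Proof.
move=> rA rB i; apply: le_trans (lerD (rA i) (rB i)).
by rewrite -big_split; apply: ler_sum => j _; rewrite mxE ler_normD.
Qed.

Lemma row_boundM A B a b : 0 <= b ->
  row_bound A a -> row_bound B b -> row_bound (A * B) (a * b).
Proof.
move=> b0 rA rB i.
apply: le_trans (ler_wpM2r b0 (rA i)).
rewrite mulr_suml.
apply: (@le_trans _ _ (\sum_j \sum_l `|A i l| * `|B l j|)).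
  apply: ler_sum => j _; rewrite mxE; apply: le_trans (ler_norm_sum _ _ _) _.
  by apply: ler_sum => l _; rewrite normrM.
rewrite exchange_big/=; apply: ler_sum => l _.
by rewrite -mulr_sumr ler_wpM2l.
Qed.

Lemma row_boundZ A a b : row_bound A a -> row_bound (b *: A) (`|b| * a).
Proof.
move=> rA i; apply: le_trans (ler_wpM2l (normr_ge0 b) (rA i)).
by rewrite mulr_sumr; apply: ler_sum => j _; rewrite mxE normrM.
Qed.

Lemma row_bound0 : row_bound 0 0.
Proof. by move=> i; rewrite big1// => j _; rewrite mxE normr0. Qed.

Lemma row_bound1 : row_bound 1 1.
Proof.
move=> i; rewrite (bigD1 i)//= mxE eqxx normr1 big1 ?addr0// => j ji.
by rewrite mxE eq_sym (negbTE ji) normr0.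
Qed.

Lemma row_bound_sum I (r : seq I) (F : I -> 'M[R]_q) (f : I -> R) (Q' : pred I) :
  (forall i, row_bound (F i) (f i)) ->
  row_bound (\sum_(i <- r | Q' i) F i) (\sum_(i <- r | Q' i) f i).
Proof.
by move=> rF; elim/big_rec2: _ => [|i A a _ rA]; [exact: row_bound0|exact: row_boundD].
Qed.

Lemma row_boundX A a i : 0 <= a -> row_bound A a -> row_bound (A ^+ i) (a ^+ i).
Proof.
move=> a0 rA; elim: i => [|i IH]; first by rewrite !expr0; exact: row_bound1.
by rewrite !exprS; apply: row_boundM => //; exact: exprn_ge0.
Qed.

Lemma row_bound_entry A a i j : row_bound A a -> `|A i j| <= a.
Proof.
move=> /(_ i); apply: le_trans; rewrite (bigD1 j)//= lerDl; exact: sumr_ge0.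
Qed.

Lemma row_bound_tr A a : row_bound A a -> `|\tr A| <= q%:R * a.
Proof.
move=> rA; apply: le_trans (ler_norm_sum _ _ _) _.
apply: (@le_trans _ _ (\sum_(i < q) a)); last by rewrite sumr_const card_ord mulr_natl.
by apply: ler_sum => i _; exact: row_bound_entry.
Qed.

Lemma row_bound_exp_sub X E x e i : 0 <= x -> 0 <= e ->
  row_bound X x -> row_bound E e ->
  row_bound ((X + E) ^+ i - X ^+ i) ((x + e) ^+ i - x ^+ i).
Proof.
move=> x0 e0 rX rE; elim: i => [|i IH].
  by rewrite !expr0 !subrr; exact: row_bound0.
have -> : (X + E) ^+ i.+1 - X ^+ i.+1 =
    (X + E) * ((X + E) ^+ i - X ^+ i) + E * X ^+ i.
  by rewrite mulrBr !exprS mulrDl [(X + E) * X ^+ i]mulrDl opprD addrA subrK.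
have -> : (x + e) ^+ i.+1 - x ^+ i.+1 =
    (x + e) * ((x + e) ^+ i - x ^+ i) + e * x ^+ i.
  by rewrite !exprS; ring.
apply: row_boundD; apply: row_boundM => //; rewrite ?exprn_ge0//.
- by rewrite subr_ge0 lerXn2r// ?nnegrE ?addr_ge0// lerDl.
- exact: row_boundD.
- exact: row_boundX.
Qed.

(** Each product [y_i A_ij y_j] is at most [|A_ij| (y_i^2 + y_j^2) / 2]. *)
Lemma psd_row_bound A a : sym A -> row_bound A a -> psd (a *: (1 : 'M[R]_q) - A).
Proof.
move=> sA rA y; rewrite qformB qformZ qform1E qformE subr_ge0.
rewrite -[leRHS](@mulfK _ 2) ?pnatr_eq0// ler_pdivlMr//.
have H i j : y 0 i * A i j * y 0 j * 2 <= `|A i j| * y 0 i ^+ 2 + `|A i j| * y 0 j ^+ 2.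
  have := ler_norm (A i j); have := ler_norm (- A i j); rewrite normrN.
  have := sqr_ge0 (y 0 i - y 0 j); have := sqr_ge0 (y 0 i + y 0 j).
  set u := y 0 i; set v := y 0 j; set z := `|_|; set w := A i j => h1 h2 h3 h4.
  have := mulr_ge0 h1 (_ : 0 <= z - w); have := mulr_ge0 h2 (_ : 0 <= z + w).
  by rewrite !subr_ge0 => /(_ ltac:(lra)) + /(_ h4); lra.
rewrite mulr_suml.
apply: (@le_trans _ _ (\sum_i \sum_j (`|A i j| * y 0 i ^+ 2 + `|A i j| * y 0 j ^+ 2))).
  by apply: ler_sum => i _; rewrite mulr_suml; apply: ler_sum => j _; exact: H.
under eq_bigr do rewrite big_split/=.
rewrite big_split/= mulr_natr mulr2n mulr_sumr; apply: lerD; last rewrite exchange_big/=.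
  by apply: ler_sum => i _; rewrite -mulr_suml ler_wpM2r ?sqr_ge0 ?rA.
apply: ler_sum => j _; rewrite -mulr_suml ler_wpM2r ?sqr_ge0//.
have sAE i : A i j = A j i by rewrite -{1}(sA : A^T = A) mxE.
under eq_bigr do rewrite sAE; exact: rA.
Qed.

End row_sum_norm.

(** * Scalar estimates and a discrete Golden-Thompson inequality *)

Section scalar.
Context {R : realType}.
Implicit Types s t x a b : R.

Lemma exp1Dx_le_expR t p : 0 <= t -> (1 + t) ^+ p <= expR (p%:R * t).
Proof.
move=> t0; rewrite expRM_natl lerXn2r// ?nnegrE ?expR_ge0 ?addr_ge0//.
exact: expR_ge1Dx.
Qed.

(** The mean value theorem for powers, with a lossy right-hand side: the
    factor [a ^+ p] in place of [a ^+ p.-1] is harmless here. *)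
Lemma exp_sub_le a b p : 0 <= b -> b <= a -> 1 <= a ->
  a ^+ p - b ^+ p <= p%:R * (a - b) * a ^+ p.
Proof.
move=> b0 ba a1; elim: p => [|p IH]; first by rewrite !expr0 subrr mulr0n !mul0r.
have -> : a ^+ p.+1 - b ^+ p.+1 = a * (a ^+ p - b ^+ p) + (a - b) * b ^+ p.
  by rewrite !exprS; ring.
have -> : p.+1%:R * (a - b) * a ^+ p.+1 =
    a * (p%:R * (a - b) * a ^+ p) + (a - b) * a ^+ p.+1.
  by rewrite exprS -natr1; ring.
apply: lerD; first by rewrite ler_wpM2l//; lra.
rewrite ler_wpM2l ?subr_ge0//; apply: (@le_trans _ _ (a ^+ p)).
  by rewrite lerXn2r ?nnegrE//; lra.
by rewrite exprS ler_peMl// exprn_ge0//; lra.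
Qed.

(** The bound [e^s - 1 - s <= (s^2/2) / (1 - s/3)] of the scalar Bernstein
    inequality, for the powers that approximate the exponential. *)
Lemma scalar_remainder_bernstein p t : 0 <= t -> p%:R * t < 3 ->
  scalar_remainder p t <= (p%:R * t) ^+ 2 / 2 / (1 - p%:R * t / 3).
Proof.
move=> t0; elim: p => [_|p IH pt].
  by rewrite /scalar_remainder expr0 mulr0n !mul0r expr0n/= !mul0r; lra.
have e : scalar_remainder p.+1 t = scalar_remainder p t * (1 + t) + p%:R * t * t.
  by rewrite /scalar_remainder exprS -natr1; ring.
move: pt; rewrite e -natr1 mulrDl mul1r; set s := p%:R * t => pt.
have s0 : 0 <= s by rewrite mulr_ge0.
have {}IH := IH (_ : s < 3).
apply: (@le_trans _ _ (s ^+ 2 / 2 / (1 - s / 3) * (1 + t) + s * t)).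
  by rewrite lerD2r ler_wpM2r// ?addr_ge0// IH//; lra.
rewrite -subr_ge0.
have -> : (s + t) ^+ 2 / 2 / (1 - (s + t) / 3) -
    (s ^+ 2 / 2 / (1 - s / 3) * (1 + t) + s * t) =
    (s ^+ 3 * t + (9 + 3 * s + s ^+ 2) * t ^+ 2) / (2 * (3 - s) * (3 - (s + t))).
  by field; rewrite !gt_eqF//; lra.
apply: divr_ge0; last by rewrite !mulr_ge0//; lra.
by rewrite addr_ge0// !mulr_ge0 ?exprn_ge0// addr_ge0 ?exprn_ge0//; lra.
Qed.

(** From [exp (t / (p + t)) <= (p + t) / p], which loses a factor [exp (- t^2
    / (p + t))]. *)
Lemma expR_le_exp1Dx t p : 0 <= t -> (0 < p)%N -> 8 * t ^+ 2 <= p%:R ->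
  7 / 8 * expR t <= (1 + t / p%:R) ^+ p.
Proof.
move=> t0 p0 tp; have p0' : 0 < p%:R :> R by rewrite ltr0n.
have pt0 : 0 < p%:R + t by rewrite ltr_pwDl.
apply: (@le_trans _ _ (expR (p%:R * (t / (p%:R + t))))).
  have -> : p%:R * (t / (p%:R + t)) = t + - (t ^+ 2 / (p%:R + t)).
    by field; rewrite gt_eqF.
  rewrite expRD mulrC ler_wpM2l ?expR_ge0//.
  apply: le_trans (expR_ge1Dx _).
  suff : t ^+ 2 / (p%:R + t) <= 1 / 8 by lra.
  by rewrite ler_pdivrMr//; lra.
rewrite expRM_natl lerXn2r ?nnegrE ?expR_ge0 ?addr_ge0 ?divr_ge0//.
have := expR_ge1Dx (- (t / (p%:R + t))).
have -> : 1 - t / (p%:R + t) = p%:R / (p%:R + t) by field; rewrite gt_eqF.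
rewrite expRN => h.
have -> : 1 + t / p%:R = (p%:R / (p%:R + t))^-1 by field; rewrite !gt_eqF.
by rewrite -[leLHS]invrK lef_pV2// posrE ?invr_gt0 ?expR_gt0// divr_gt0.
Qed.

Lemma affine_recursion (h : nat -> R) (kappa t eta : R) : 0 < kappa ->
  0 <= t -> 0 <= eta -> h 0 = 0 ->
  (forall j, h j.+1 <= (1 + kappa) * h j + kappa * t + eta) ->
  forall j, h j <= (t + eta / kappa) * expR (j%:R * kappa).
Proof.
move=> k0 t0 e0 h0 hS j.
have te0 : 0 <= t + eta / kappa by rewrite addr_ge0// divr_ge0// ltW.
suff H : h j <= (t + eta / kappa) * ((1 + kappa) ^+ j - 1).
  apply: le_trans H _; rewrite ler_wpM2l//.
  by have := exp1Dx_le_expR j (ltW k0); lra.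
elim: j => [|j IH]; first by rewrite h0 expr0 subrr mulr0.
apply: le_trans (hS j) _; rewrite exprS.
have := ler_wpM2l (_ : 0 <= 1 + kappa) IH => /(_ ltac:(lra)).
suff -> : (t + eta / kappa) * ((1 + kappa) * (1 + kappa) ^+ j - 1) =
  (1 + kappa) * ((t + eta / kappa) * ((1 + kappa) ^+ j - 1)) + kappa * t + eta by lra.
by field; rewrite gt_eqF.
Qed.

End scalar.

(** A discrete form of the Golden-Thompson inequality, with
    [(1 + A/p)^p] in the role of [exp A]. *)
Lemma golden_thompson_pow2 (R : realType) q k p (A B : 'M[R]_q) (c : R) :
  sym A -> sym B -> 0 <= c -> row_bound A c -> row_bound B c ->
  p = (2 ^ k)%N ->
  \tr ((1 + p%:R^-1 *: (A + B)) ^+ p) <=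
  \tr ((1 + p%:R^-1 *: A) ^+ p * (1 + p%:R^-1 *: B) ^+ p) +
  q%:R * c ^+ 2 * expR (2 * c + 2 * c ^+ 2) / p%:R.
Proof.
move=> sA sB c0 rA rB pE.
have p1 : 1 <= p%:R :> R by rewrite ler1n pE expn_gt0.
have p0 : 0 < p%:R :> R by rewrite (lt_le_trans ltr01).
have ip0 : 0 <= p%:R^-1 :> R by rewrite invr_ge0 ltW.
have s1 (C : 'M[R]_q) : sym C -> sym (1 + p%:R^-1 *: C).
  by move=> sC; apply: symD; [exact: sym1|exact: symZ].
have := lieb_thirring k (s1 _ sA) (s1 _ sB).
rewrite -pE; set X := (1 + _) * (1 + _).
set x := (1 + c / p%:R) ^+ 2; set e := (c / p%:R) ^+ 2.
set E := - (p%:R^-1 ^+ 2 *: (A * B)).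
have XE : X + E = 1 + p%:R^-1 *: (A + B).
  rewrite /X /E mulrDr mulr1 mulrDl mul1r -scaleMl -scaleMr scalerA -expr2.
  by rewrite !addrA addrK scalerDr addrA.
have r1 (C : 'M[R]_q) : row_bound C c -> row_bound (1 + p%:R^-1 *: C) (1 + c / p%:R).
  move=> rC; apply: row_boundD; first exact: row_bound1.
  by have := row_boundZ p%:R^-1 rC; rewrite ger0_norm// mulrC.
have rX : row_bound X x.
  rewrite /x expr2; apply: row_boundM; [|exact: r1|exact: r1].
  by rewrite addr_ge0// divr_ge0// ltW.
have rE : row_bound E e.
  have := row_boundZ (- (p%:R^-1 ^+ 2)) (row_boundM c0 rA rB).
  by rewrite normrN ger0_norm ?exprn_ge0// scaleNr /e exprMn mulrC -expr2.
have x0 : 0 <= x by exact: sqr_ge0.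
have e0 : 0 <= e by exact: sqr_ge0.
have := row_bound_tr (row_bound_exp_sub p x0 e0 rX rE).
rewrite XE linearB/= => /(le_trans (ler_norm _)) h1 h2.
suff : q%:R * ((x + e) ^+ p - x ^+ p) <=
  q%:R * c ^+ 2 * expR (2 * c + 2 * c ^+ 2) / p%:R by lra.
rewrite -!mulrA ler_wpM2l//.
have xe1 : 1 <= x + e.
  rewrite ler_wpDr// /x exprn_ege1// lerDl divr_ge0//; lra.
apply: le_trans (exp_sub_le _ _ _ _) _ => //; first by rewrite lerDl.
rewrite addrAC subrr add0r /e mulrA.
have -> : p%:R * (c / p%:R) ^+ 2 = c ^+ 2 / p%:R by field; rewrite gt_eqF.
have -> : c ^+ 2 * (expR (2 * c + 2 * c ^+ 2) / p%:R) =
    c ^+ 2 / p%:R * expR (2 * c + 2 * c ^+ 2) by rewrite mulrA mulrAC.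
apply: ler_wpM2l; first by rewrite divr_ge0 ?sqr_ge0// ltW.
set t := (2 * c + 2 * c ^+ 2) / p%:R.
have t0 : 0 <= t by rewrite divr_ge0// ?addr_ge0// ?mulr_ge0 ?sqr_ge0// ltW.
have -> : 2 * c + 2 * c ^+ 2 = p%:R * t by rewrite /t; field; rewrite gt_eqF.
apply: le_trans (exp1Dx_le_expR p t0).
rewrite lerXn2r ?nnegrE ?addr_ge0//.
rewrite /x /t -/e -subr_ge0.
have -> : 1 + (2 * c + 2 * c ^+ 2) / p%:R - ((1 + c / p%:R) ^+ 2 + e) =
    2 * c ^+ 2 / p%:R * (1 - p%:R^-1) by rewrite /e; field; rewrite gt_eqF.
by rewrite !mulr_ge0 ?sqr_ge0// subr_ge0 invf_le1.
Qed.

(** * Means of bounded measurable functions *)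

Section bounded_measurable.
Context {d : measure_display} {T : measurableType d} {R : realType}.
Implicit Types f g : T -> R.

(** On a probability space these functions form an algebra on which the mean
    is linear without any integrability condition; all random matrices below
    have such entries. *)
Definition bmeas f := measurable_fun setT f /\ exists M, forall x, `|f x| <= M.

Lemma bmeas_cst (c : R) : bmeas (fun=> c).
Proof. by split; [exact: measurable_cst|exists `|c|]. Qed.

Lemma bmeasD f g : bmeas f -> bmeas g -> bmeas (fun x => f x + g x).
Proof.
move=> [mf [M fM]] [mg [N gN]]; split; first exact: measurable_funD.
by exists (M + N) => x; apply: le_trans (ler_normD _ _) (lerD (fM x) (gN x)).
Qed.

Lemma bmeasM f g : bmeas f -> bmeas g -> bmeas (fun x => f x * g x).
Proof.
move=> [mf [M fM]] [mg [N gN]]; split; first exact: measurable_funM.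
by exists (M * N) => x; rewrite normrM ler_pM.
Qed.

Lemma bmeas_sum I (r : seq I) (Q : pred I) (F : I -> T -> R) :
  (forall i, bmeas (F i)) -> bmeas (fun x => \sum_(i <- r | Q i) F i x).
Proof.
move=> bF; elim: r => [|i r IH].
  by under eq_fun do rewrite big_nil; exact: bmeas_cst.
under eq_fun do rewrite big_cons.
by case: (Q i) => //; exact: bmeasD.
Qed.

Definition bmeas_mx q (F : T -> 'M[R]_q) := forall i j, bmeas (fun x => F x i j).

Lemma bmeas_mx_cst q (A : 'M[R]_q) : bmeas_mx (fun=> A).
Proof. by move=> i j; exact: bmeas_cst. Qed.

Lemma bmeas_mxD q (F G : T -> 'M[R]_q) :
  bmeas_mx F -> bmeas_mx G -> bmeas_mx (fun x => F x + G x).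
Proof.
by move=> bF bG i j; under eq_fun do rewrite mxE; exact: bmeasD.
Qed.

Lemma bmeas_mxZ q (c : R) (F : T -> 'M[R]_q) :
  bmeas_mx F -> bmeas_mx (fun x => c *: F x).
Proof.
by move=> bF i j; under eq_fun do rewrite mxE; exact/bmeasM/bF/bmeas_cst.
Qed.

Lemma bmeas_mxB q (F G : T -> 'M[R]_q) :
  bmeas_mx F -> bmeas_mx G -> bmeas_mx (fun x => F x - G x).
Proof.
move=> bF bG; under eq_fun do rewrite -scaleN1r.
exact: bmeas_mxD bF (bmeas_mxZ _ bG).
Qed.

Lemma bmeas_mxM q (F G : T -> 'M[R]_q) :
  bmeas_mx F -> bmeas_mx G -> bmeas_mx (fun x => F x * G x).
Proof.
move=> bF bG i j; under eq_fun do rewrite mxE.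
by apply: bmeas_sum => l; exact: bmeasM.
Qed.

Lemma bmeas_mxX q (F : T -> 'M[R]_q) p :
  bmeas_mx F -> bmeas_mx (fun x => F x ^+ p).
Proof.
move=> bF; elim: p => [|p IH]; first exact: bmeas_mx_cst.
by under eq_fun do rewrite exprS; exact: bmeas_mxM.
Qed.

Lemma bmeas_tr q (F : T -> 'M[R]_q) : bmeas_mx F -> bmeas (fun x => \tr (F x)).
Proof. by move=> bF; apply: bmeas_sum => i; exact: bF. Qed.

End bounded_measurable.

Section expectation.
Context {d : measure_display} {T : measurableType d} {R : realType}.
Variable P : probability T R.
Implicit Types f g : T -> R.

Lemma bmeas_integrable f : bmeas f -> P.-integrable setT (EFin \o f).
Proof.
move=> [mf [M fM]]; apply: measurable_bounded_integrable => //.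
  by have := ltry (1 : R); rewrite -(probability_setT P).
by exists M; split; [exact: num_real|move=> N MN x _; exact: le_trans (fM x) (ltW MN)].
Qed.

Definition mean f : R := \int[P]_x f x.

Lemma mean_cst c : mean (fun=> c) = c.
Proof.
rewrite /mean Rintegral_cst//.
have e : fine (P setT) = 1 by rewrite probability_setT.
by rewrite -[RHS]mulr1 -e.
Qed.

Lemma meanD f g : bmeas f -> bmeas g -> mean (fun x => f x + g x) = mean f + mean g.
Proof. by move=> bf bg; rewrite /mean RintegralD//; exact: bmeas_integrable. Qed.

Lemma meanZ c f : bmeas f -> mean (fun x => c * f x) = c * mean f.
Proof. by move=> bf; rewrite /mean RintegralZl//; exact: bmeas_integrable. Qed.

Lemma mean_sum I (r : seq I) (Q : pred I) (F : I -> T -> R) :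
  (forall i, bmeas (F i)) ->
  mean (fun x => \sum_(i <- r | Q i) F i x) = \sum_(i <- r | Q i) mean (F i).
Proof.
move=> bF; elim: r => [|i r IH].
  by rewrite big_nil; under eq_fun do rewrite big_nil; exact: mean_cst.
rewrite big_cons; under eq_fun do rewrite big_cons.
by case: (Q i) => //; rewrite meanD ?IH//; exact: bmeas_sum.
Qed.

Lemma mean_le f g : bmeas f -> bmeas g -> (forall x, f x <= g x) -> mean f <= mean g.
Proof.
by move=> bf bg fg; apply: le_Rintegral => //; exact: bmeas_integrable.
Qed.

Lemma mean_ge0 f : (forall x, 0 <= f x) -> 0 <= mean f.
Proof. by move=> f0; apply: Rintegral_ge0. Qed.

Lemma markov_bmeas f (a : R) : bmeas f -> (forall x, 0 <= f x) -> 0 < a ->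
  measurable [set x | a <= f x] /\ (P [set x | (a <= f x)%R] <= (mean f / a)%:E)%E.
Proof.
move=> bf f0 a0.
set A := [set x | a <= f x].
have mA : measurable A.
  have : measurable_fun setT (fun x => a <= f x).
    by apply: measurable_fun_ler => //; exact: bf.1.
  by move=> /(_ measurableT [set true] I); rewrite setTI.
split=> //.
have bA : bmeas (\1_A : T -> R).
  split; first exact: measurable_indic.
  by exists 1 => x; rewrite indicE; case: (_ \in _); rewrite ?normr1 ?normr0.
have EA : P A = (mean \1_A)%:E.
  rewrite /mean /Rintegral fineK; last exact/integrable_fin_num/bmeas_integrable.
  by rewrite integral_indic// setIT.
rewrite EA lee_fin ler_pdivlMr// mulrC -meanZ//.
apply: mean_le => // [|x]; first exact: bmeasM (bmeas_cst _) bA.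
by rewrite indicE; case: (boolP (x \in A)) => [|_]; rewrite ?mulr0// inE mulr1.
Qed.

(** The joint law of [f] and [g] is the product of their laws, and the product
    is integrated by Fubini's theorem. *)
Lemma mean_mul_indep f g : bmeas f -> bmeas g ->
  (forall B C, measurable B -> measurable C ->
    P (f @^-1` B `&` g @^-1` C) = (P (f @^-1` B) * P (g @^-1` C))%E) ->
  mean (fun x => f x * g x) = mean f * mean g.
Proof.
move=> bf bg ind.
pose f' : {mfun T >-> R} := HB.pack f (isMeasurableFun.Build _ _ _ _ f bf.1).
pose g' : {mfun T >-> R} := HB.pack g (isMeasurableFun.Build _ _ _ _ g bg.1).
have mfg : measurable_fun setT (fun x => (f x, g x)).
  exact: measurable_fun_pair bf.1 bg.1.
pose fg : {mfun T >-> (R * R)%type} := HB.pack (fun x => (f x, g x))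
  (isMeasurableFun.Build _ _ _ _ (fun x => (f x, g x)) mfg).
pose m1 := distribution P f'; pose m2 := distribution P g'.
pose m := distribution P fg.
have mE : forall X : set (R * R), measurable X -> (m1 \x m2)%E X = m X.
  by apply: product_measure_unique => B C mB mC; exact: ind.
pose h (z : R * R) := (z.1 * z.2)%:E.
have mh : measurable_fun setT h.
  by apply/measurable_EFinP/measurable_funM.
have ih : P.-integrable setT (h \o fg).
  exact: bmeas_integrable (bmeasM bf bg).
have e1 : (\int[P]_x (f x * g x)%:E = \int[m]_z h z)%E.
  by rewrite /m integral_distribution.
have e2 : (\int[m]_z h z = \int[m1 \x m2]_z h z)%E.
  by apply: eq_measure_integral => A mA _; exact/esym/mE.
have i2 : (m1 \x m2)%E.-integrable setT h.
  have := integrable_pushforward (mfg) mh ih measurableT.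
  move=> /integrableP[? H]; apply/integrableP; split => //.
  by rewrite (eq_measure_integral m)// => A mA _; exact: mE.
have fin u : bmeas u -> (\int[P]_x (u x)%:E = (mean u)%:E)%E.
  by move=> bu; rewrite /mean /Rintegral fineK//; exact/integrable_fin_num/bmeas_integrable.
have eg : (\int[m2]_y y%:E = (mean g)%:E)%E.
  rewrite -fin//; apply: (@integral_distribution _ _ _ _ _ P g' EFin).
    exact: EFin_measurable.
  exact: bmeas_integrable.
have ef : (\int[m1]_y y%:E = (mean f)%:E)%E.
  rewrite -fin//; apply: (@integral_distribution _ _ _ _ _ P f' EFin).
    exact: EFin_measurable.
  exact: bmeas_integrable.
apply: EFin_inj; rewrite -fin; last exact: bmeasM.
rewrite e1 e2 -integral12_prod_meas1// /h/=.
have i1 : m1.-integrable setT EFin.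
  exact: (integrable_pushforward bf.1 _ (bmeas_integrable bf) measurableT).
have ig : m2.-integrable setT EFin.
  exact: (integrable_pushforward bg.1 _ (bmeas_integrable bg) measurableT).
transitivity (\int[m1]_x (x%:E * (mean g)%:E))%E.
  apply: eq_integral => x _; rewrite /fubini_F/=.
  by under eq_integral do rewrite EFinM; rewrite integralZl// eg.
by rewrite integralZr// ef -EFinM.
Qed.

End expectation.

(** * Independence of a sample and its past *)

Lemma bmeas_comp_rv {dT} {T : measurableType dT} {d} {Omega : measurableType d}
    {R : realType} {P : probability Omega R} (xi : {RV P >-> T}) (g : T -> R) :
  bmeas g -> bmeas (fun om => g (xi om)).
Proof.
move=> [mg [M gM]]; split; first exact: measurableT_comp mg (measurable_funP xi).
by exists M => om; exact: gM.
Qed.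

Section past.
Context {dT : measure_display} {T : measurableType dT}.
Context {d : measure_display} {Omega : measurableType d} {R : realType}.
Variables (P : probability Omega R) (m : nat) (x : 'I_m -> {RV P >-> T}).

(** A pi-system that generates the sigma-algebra of the first [j] variables;
    measurability for that sigma-algebra expresses dependence on the past
    only. *)
Definition cylinders (j : nat) : set (set Omega) :=
  [set B | exists A : 'I_m -> set T, (forall i, measurable (A i)) /\
    B = \bigcap_(i in [set` [set i : 'I_m | (i < j)%N]%SET]) (x i @^-1` A i)].

Notation past j := (g_sigma_algebraType (cylinders j)).

Lemma setI_closed_cylinders j : setI_closed (cylinders j).
Proof.
move=> _ _ [A [mA ->]] [B [mB ->]]; exists (fun i => A i `&` B i); split.
  by move=> i; exact: measurableI.
by rewrite -bigcapI; apply: eq_bigcapr => i _; rewrite preimage_setI.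
Qed.

Lemma measurable_past j (S : set Omega) : <<s cylinders j >> S -> measurable S.
Proof.
have : <<s cylinders j >> `<=` (@measurable _ Omega).
  apply: smallest_sub; first exact: sigma_algebra_measurable.
  move=> _ [A [mA ->]]; apply: fin_bigcap_measurable => [|i _]; first exact: finite_finset.
  by rewrite -[X in measurable X]setTI; exact: measurable_funP.
exact.
Qed.

Lemma bmeas_past_self j (f : Omega -> R) :
  @bmeas _ (past j) R f -> bmeas f.
Proof.
move=> [mf bf]; split=> // _ B mB; apply: (@measurable_past j).
exact: mf.
Qed.

Lemma bmeas_past (i : 'I_m) j (g : T -> R) : (i < j)%N -> bmeas g ->
  @bmeas _ (past j) R (fun om => g (x i om)).
Proof.
move=> ij [mg [M gM]]; split; last by exists M => om; exact: gM.
move=> _ B mB; rewrite setTI; apply: sub_sigma_algebra.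
exists (fun l => if l == i then g @^-1` B else setT); split.
  by move=> l; case: ifP => // _; rewrite -[X in measurable X]setTI; exact: mg.
apply/seteqP; split=> om /=.
  by move=> Bg l _; case: eqP => // ->.
by move=> /(_ i); rewrite /= inE eqxx; apply.
Qed.

Hypothesis ind : mutually_independent x.

(** Both sides are finite measures in [S] that agree on cylinders by mutual
    independence, and cylinders are closed under intersection. *)
Lemma past_indep (j : 'I_m) (S : set Omega) (C : set T) : measurable C ->
  <<s cylinders j >> S -> P (S `&` x j @^-1` C) = (P S * P (x j @^-1` C))%E.
Proof.
move=> mC; set D := x j @^-1` C.
have mD : measurable D.
  by rewrite -[X in measurable X]setTI; exact: measurable_funP.
apply: (@dynkin_induction _ (past j) (cylinders j)
  (fun S => P (S `&` D) = (P S * P D)%E)) => //.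
- exact: setI_closed_cylinders.
- by rewrite setTI probability_setT mul1e.
- move=> _ [A [mA ->]].
  pose A' i := if i == j then C else A i.
  have mA' i : measurable (A' i) by rewrite /A'; case: ifP.
  have := ind (j |: [set i : 'I_m | (i < j)%N])%SET mA'.
  rewrite big_setU1/=; last by rewrite inE ltnn.
  rewrite {2}/A' eqxx muleC => h.
  rewrite (_ : \prod_(i in _) _ =
    \prod_(i in [set i : 'I_m | (i < j)%N]%SET) P (x i @^-1` A i))%E in h; last first.
    apply: eq_bigr => i; rewrite inE /A' => ij; case: eqP ij => // ->.
    by rewrite ltnn.
  rewrite ind// -h; congr (P _); apply/seteqP; split => om /=.
    move=> [H Dx] i; rewrite /= !inE /A'; case: eqP => [->//|_] /= ij.
    by apply: H; rewrite /= inE.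
  move=> H; split.
    move=> i /=; rewrite inE => ij; have := H i.
    by rewrite /= !inE ij orbT /A' => /(_ isT); case: eqP ij => // ->; rewrite ltnn.
  by have := H j; rewrite /= !inE eqxx /A' eqxx; exact.
- move=> B /measurable_past mB PB.
  have -> : ~` B `&` D = D `\` (B `&` D).
    by rewrite setDIr setDv setU0 setDE setIC.
  rewrite measureD//; last 2 first.
    exact: measurableI.
    by rewrite (le_lt_trans (probability_le1 P mD)) ?ltry.
  rewrite setICA setIid; apply: etrans (congr1 (fun z => P D - z)%E PB) _.
  rewrite probability_setC// muleBl ?mul1e//; first exact: fin_num_measure.
- move=> F mF tF PF.
  rewrite setI_bigcupl measure_bigcup//=; last 2 first.
    by move=> i _; apply: measurableI => //; exact: measurable_past (mF i).
    exact: trivIset_setIr.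
  rewrite measure_bigcup//; last by move=> i _; exact: measurable_past (mF i).
  have PD : P D = (fine (P D))%:E by rewrite fineK//; exact: fin_num_measure.
  rewrite [RHS]muleC PD -nneseriesZl; last by move=> i _; exact: measure_ge0.
  by apply: eq_eseriesr => i _; rewrite -PD muleC; exact: PF.
Qed.

Lemma mean_past_mul (j : 'I_m) (f : Omega -> R) (g : T -> R) :
  @bmeas _ (past j) R f -> bmeas g ->
  mean P (fun om => f om * g (x j om)) = mean P f * mean P (fun om => g (x j om)).
Proof.
move=> bf bg; apply: mean_mul_indep; [exact: bmeas_past_self bf|exact: bmeas_comp_rv|].
move=> B C mB mC.
rewrite (_ : (fun om => g (x j om)) @^-1` C = x j @^-1` (g @^-1` C))//.
apply: past_indep; first by rewrite -[X in measurable X]setTI; exact: bg.1.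
by have := bf.1 measurableT _ mB; rewrite setTI.
Qed.

End past.
Notation past x j := (g_sigma_algebraType (cylinders x j)).

(** * A matrix Bernstein inequality with intrinsic dimension *)

Lemma scalar_remainder_ge (R : realFieldType) p (t : R) : 0 <= t ->
  (p%:R * (p%:R - 1)) / 2 * t ^+ 2 <= scalar_remainder p t.
Proof.
move=> t0; elim: p => [|p IH].
  by rewrite /scalar_remainder expr0 mulr0n !mul0r subrr subr0.
have -> : scalar_remainder p.+1 t = scalar_remainder p t * (1 + t) + p%:R * t ^+ 2.
  by rewrite /scalar_remainder exprS -natr1; ring.
have r0 : 0 <= scalar_remainder p t.
  apply: le_trans IH; rewrite mulr_ge0 ?sqr_ge0// divr_ge0//.
  case: p => [|p]; first by rewrite mul0r.
  by rewrite -natr1 addrK mulr_ge0// addr_ge0.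
have := mulr_ge0 r0 t0; rewrite -natr1; lra.
Qed.

(** The linear arithmetic of one step of the recursion, kept apart from the
    matrix context. *)
Lemma potential_arith (R : realFieldType) (h h' b c e f k t u : R) :
  h' + u <= b + e -> b <= c + k * f -> c = h + u -> k * f <= k * (t + h) ->
  h' <= (1 + k) * h + k * t + e.
Proof. by move=> ? ? ?; lra. Qed.

Section mean_matrix.
Context {d : measure_display} {T : measurableType d} {R : realType} {q : nat}.
Variable P : probability T R.
Implicit Types F G : T -> 'M[R]_q.

Definition mean_mx F : 'M[R]_q := \matrix_(a, b) mean P (fun om => F om a b).

Lemma mean_mx_cst (A : 'M[R]_q) : mean_mx (fun=> A) = A.
Proof. by apply/matrixP => a b; rewrite mxE mean_cst. Qed.

Lemma mean_mxD F G : bmeas_mx F -> bmeas_mx G ->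
  mean_mx (fun om => F om + G om) = mean_mx F + mean_mx G.
Proof.
move=> bF bG; apply/matrixP => a b; rewrite !mxE.
by under eq_fun do rewrite mxE; rewrite meanD.
Qed.

Lemma mean_mxZ c F : bmeas_mx F -> mean_mx (fun om => c *: F om) = c *: mean_mx F.
Proof.
move=> bF; apply/matrixP => a b; rewrite !mxE.
by under eq_fun do rewrite mxE; rewrite meanZ.
Qed.

Lemma mean_mxB F G : bmeas_mx F -> bmeas_mx G ->
  mean_mx (fun om => F om - G om) = mean_mx F - mean_mx G.
Proof.
move=> bF bG; rewrite -scaleN1r -mean_mxZ// -mean_mxD//; last exact: bmeas_mxZ.
by under [in RHS]eq_fun do rewrite scaleN1r.
Qed.

Lemma mean_mx_mull (A : 'M[R]_q) F : bmeas_mx F ->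
  mean_mx (fun om => A * F om) = A * mean_mx F.
Proof.
move=> bF; apply/matrixP => a b; rewrite !mxE.
under eq_fun do rewrite mxE.
rewrite mean_sum; last by move=> l; exact/bmeasM/bF/bmeas_cst.
by apply: eq_bigr => l _; rewrite mxE meanZ.
Qed.

Lemma mean_mx_mulr (A : 'M[R]_q) F : bmeas_mx F ->
  mean_mx (fun om => F om * A) = mean_mx F * A.
Proof.
move=> bF; apply/matrixP => a b; rewrite !mxE.
under eq_fun do rewrite mxE.
rewrite mean_sum; last by move=> l; exact/bmeasM/bmeas_cst/bF.
apply: eq_bigr => l _; rewrite mxE mulrC -meanZ//.
by under eq_fun do rewrite mulrC.
Qed.

Lemma mean_tr F : bmeas_mx F -> mean P (fun om => \tr (F om)) = \tr (mean_mx F).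
Proof.
move=> bF; rewrite /mxtrace mean_sum; last by move=> i; exact: bF.
by apply: eq_bigr => i _; rewrite mxE.
Qed.

Lemma mean_qform F y : bmeas_mx F -> mean P (fun om => qform (F om) y) = qform (mean_mx F) y.
Proof.
move=> bF; rewrite qformE; under eq_fun do rewrite qformE.
have b i j : bmeas (fun om => y 0 i * F om i j * y 0 j).
  by apply: bmeasM (bmeas_cst _); apply: bmeasM (bmeas_cst _) _.
rewrite mean_sum; last by move=> i; exact: bmeas_sum.
apply: eq_bigr => i _; rewrite mean_sum//; apply: eq_bigr => j _.
under eq_fun do rewrite mulrC.
rewrite meanZ; last exact: bmeasM (bmeas_cst _) _.
by rewrite meanZ// mxE mulrC.
Qed.

Lemma psd_mean_mx F : bmeas_mx F -> (forall om, psd (F om)) -> psd (mean_mx F).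
Proof. by move=> bF pF y; rewrite -mean_qform//; apply: mean_ge0 => om; exact: pF. Qed.

Lemma bmeas_mx_row_bound F : bmeas_mx F ->
  exists2 c, 0 <= c & forall om, row_bound (F om) c.
Proof.
move=> bF; pose M a b := sval (cid (bF a b).2).
have FM om a b : `|F om a b| <= M a b by rewrite /M; case: cid => /= N; exact.
exists (\sum_a \sum_b `|M a b|).
  by apply: sumr_ge0 => a _; exact: sumr_ge0.
move=> om a; rewrite [leRHS](bigD1 a)//= ler_wpDr//.
  by apply: sumr_ge0 => b _; exact: sumr_ge0.
by apply: ler_sum => b _; apply: le_trans (FM om a b) (ler_norm _).
Qed.

End mean_matrix.

Section matrix_bernstein.
Context {dT : measure_display} {T : measurableType dT}.
Context {d : measure_display} {Omega : measurableType d} {R : realType}.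
Variables (P : probability Omega R) (m : nat) (x : 'I_m -> {RV P >-> T}).
Hypothesis ind : mutually_independent x.
Variables (q : nat) (A : T -> 'M[R]_q) (K : R) (dd : 'rV[R]_q).
Let D := diag_mx dd.
Hypothesis bA : bmeas_mx A.
Hypothesis sA : forall t, sym (A t).
Hypothesis pA : forall t, psd (A t).
Hypothesis pKA : forall t, psd (K *: A t - A t ^+ 2).
Hypothesis K0 : 0 < K.
Hypothesis dd01 : forall a, 0 <= dd 0 a <= 1.
Hypothesis EA : forall j : 'I_m, mean_mx P (fun om => A (x j om)) = D.

Section steps.
Variables (s : R) (k p : nat) (c0 : R).
Hypothesis s0 : 0 < s.
Hypothesis pE : p = (2 ^ k.+1)%N.

Let Y t := s *: (D - A t).
Hypothesis c00 : 0 <= c0.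
Hypothesis rY : forall t, row_bound (Y t) c0.
Let c := m%:R * c0.
Hypothesis cp : c <= p%:R.

Let S (j : nat) om := \sum_(i < m | (i < j)%N) Y (x i om).
Let B j om := 1 + p%:R^-1 *: S j om.

Let p0 : 0 < p%:R :> R. Proof. by rewrite ltr0n pE expn_gt0. Qed.
Let c_ge0 : 0 <= c. Proof. by rewrite mulr_ge0. Qed.

Lemma sym_step t : sym (Y t).
Proof.
apply/symZ/symD; first exact: sym_diag.
by rewrite -scaleN1r; exact: symZ.
Qed.

Lemma sym_partial_sum j om : sym (S j om).
Proof. by apply: sym_sum => i; exact: sym_step. Qed.

Lemma row_bound_partial_sum j om : row_bound (S j om) c.
Proof.
apply: (row_boundW _ (row_bound_sum _ _ (fun i => rY (x i om)))).
have -> : c = \sum_(i < m) c0 by rewrite sumr_const card_ord -mulr_natl.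
rewrite big_mkcond/=.
by apply: ler_sum => i _; case: ifP.
Qed.

(** The bound holds for every partial sum, so the powers below are powers of
    positive matrices. *)
Lemma psd_1D (X : 'M[R]_q) : sym X -> row_bound X c -> psd (1 + p%:R^-1 *: X).
Proof.
move=> sX rX.
have rNX : row_bound (- X) c.
  by have := row_boundZ (-1) rX; rewrite normrN1 mul1r scaleN1r.
have sNX : sym (- X) by rewrite -scaleN1r; exact: symZ.
have := psd_row_bound sNX rNX; rewrite opprK => H.
have -> : 1 + p%:R^-1 *: X =
    (1 - c / p%:R) *: (1 : 'M[R]_q) + p%:R^-1 *: (c *: (1 : 'M[R]_q) + X).
  by rewrite scalerDr scalerA addrA -scalerDl [p%:R^-1 * c]mulrC subrK scale1r.
apply: psdD; apply: psdZ.
- by rewrite subr_ge0 ler_pdivrMr// mul1r.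
- exact: psd1.
- by rewrite invr_ge0 ltW.
- exact: H.
Qed.

Lemma bmeas_mx_step : bmeas_mx Y.
Proof.
by apply: bmeas_mxZ; apply: bmeas_mxB => //; exact: bmeas_mx_cst.
Qed.

Lemma bmeas_mx_rv i (F : T -> 'M[R]_q) : bmeas_mx F ->
  bmeas_mx (fun om => F (x i om)).
Proof. by move=> bF a b; exact: (bmeas_comp_rv (x i) (bF a b)). Qed.

Lemma past_partial_sum j : @bmeas_mx _ (past x j) R _ (S j).
Proof.
move=> a b; rewrite /S.
have -> : (fun om => (\sum_(i < m | (i < j)%N) Y (x i om)) a b) =
    (fun om => \sum_(i < m) (if (i < j)%N then Y (x i om) a b else 0)).
  by apply/funext => om; rewrite summxE big_mkcond.
have H (i : 'I_m) : @bmeas _ (past x j) R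
    (fun om : Omega => if (i < j)%N then Y (x i om) a b else 0).
  case: (ltnP i j) => ij; last exact: bmeas_cst.
  have h : bmeas (fun t => Y t a b) by exact: bmeas_mx_step.
  exact: (bmeas_past x ij h).
exact: (bmeas_sum (index_enum _) xpredT H).
Qed.

Lemma past_base j : @bmeas_mx _ (past x j) R _ (B j).
Proof. exact/bmeas_mxD/bmeas_mxZ/past_partial_sum/bmeas_mx_cst. Qed.

Lemma bmeas_partial_sum j : bmeas_mx (S j).
Proof. by move=> a b; exact: bmeas_past_self (@past_partial_sum j a b). Qed.

Lemma bmeas_base j : bmeas_mx (B j).
Proof. by move=> a b; exact: bmeas_past_self (@past_base j a b). Qed.

Lemma mean_mx_step i : mean_mx P (fun om => Y (x i om)) = 0.
Proof.
have bAx := bmeas_mx_rv i bA.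
rewrite mean_mxZ; last by apply: bmeas_mxB => //; exact: bmeas_mx_cst.
by rewrite mean_mxB//; [rewrite mean_mx_cst EA subrr scaler0|exact: bmeas_mx_cst].
Qed.

Let kappa := K * scalar_remainder p (s / p%:R).

Lemma remainder_step_ge0 : 0 <= scalar_remainder p (s / p%:R).
Proof.
have t0 : 0 <= s / p%:R by rewrite divr_ge0 ?ltW.
apply: le_trans (scalar_remainder_ge p t0).
by rewrite mulr_ge0 ?sqr_ge0// divr_ge0// mulr_ge0// subr_ge0 ler1n pE expn_gt0.
Qed.

Lemma kappa_ge0 : 0 <= kappa.
Proof. by rewrite mulr_ge0 ?remainder_step_ge0// ltW. Qed.

(** The matrix analogue of [E e^Y <= 1 + (e^s - 1 - s) E Y^2 / s^2]. *)
Lemma psd_mean_exp i :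
  psd (1 + kappa *: D - mean_mx P (fun om => (1 + p%:R^-1 *: Y (x i om)) ^+ p)).
Proof.
set r := scalar_remainder p (s / p%:R).
have r0 : 0 <= r by exact: remainder_step_ge0.
pose Z om := D - A (x i om).
have bAx := bmeas_mx_rv i bA.
have bZ : bmeas_mx Z by apply: bmeas_mxB => //; exact: bmeas_mx_cst.
have bYx := bmeas_mx_rv i bmeas_mx_step.
have EZ2 : mean_mx P (fun om => Z om ^+ 2) = mean_mx P (fun om => A (x i om) ^+ 2) - D ^+ 2.
  have -> : (fun om => Z om ^+ 2) =
      (fun om => (D ^+ 2 - D * A (x i om)) - (A (x i om) * D - A (x i om) ^+ 2)).
    by apply/funext => om; rewrite /Z !expr2 mulrBl !mulrBr.
  have b1 : bmeas_mx (fun om => D * A (x i om)) by exact: bmeas_mxM (bmeas_mx_cst _) bAx.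
  have b2 : bmeas_mx (fun om => A (x i om) * D) by exact: bmeas_mxM bAx (bmeas_mx_cst _).
  have b3 : bmeas_mx (fun om => A (x i om) ^+ 2) by exact: bmeas_mxX.
  rewrite mean_mxB; [|exact: bmeas_mxB (bmeas_mx_cst _) b1|exact: bmeas_mxB].
  rewrite !mean_mxB//; last exact: bmeas_mx_cst.
  by rewrite mean_mx_cst mean_mx_mull// mean_mx_mulr// EA -expr2 subrr sub0r opprB.
have pZ : psd (K *: D - mean_mx P (fun om => Z om ^+ 2)).
  rewrite EZ2 opprB addrCA; apply: psdD.
    by have := psd_mul_tr D; rewrite (sym_diag dd : D^T = D).
  have := @psd_mean_mx _ _ _ _ P (fun om => K *: A (x i om) - A (x i om) ^+ 2).
  rewrite mean_mxB ?mean_mxZ ?EA//; [|exact: bmeas_mxZ|exact: bmeas_mxX].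
  apply => [|om]; last exact: pKA.
  by apply: bmeas_mxB; [exact: bmeas_mxZ|exact: bmeas_mxX].
pose G om := (1 + p%:R^-1 *: Y (x i om)) ^+ p.
have bG : bmeas_mx G by apply/bmeas_mxX/bmeas_mxD/bmeas_mxZ/bYx/bmeas_mx_cst.
pose W om := 1 + Y (x i om) + r *: Z om ^+ 2.
have bW1 : bmeas_mx (fun om => 1 + Y (x i om)) by exact/bmeas_mxD/bYx/bmeas_mx_cst.
have bW2 : bmeas_mx (fun om => r *: Z om ^+ 2) by exact/bmeas_mxZ/bmeas_mxX.
have bW : bmeas_mx W by exact: bmeas_mxD.
have pWG : psd (mean_mx P (fun om => W om - G om)).
  apply: psd_mean_mx => [|om]; first exact: bmeas_mxB.
  have sX : sym (p%:R^-1 *: Y (x i om)) by apply/symZ/sym_step.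
  have m1 : (0 < m)%N := leq_ltn_trans (leq0n _) (ltn_ord i).
  have pX : psd (1 + p%:R^-1 *: Y (x i om)).
    apply: psd_1D; first exact: sym_step.
    by apply: (row_boundW _ (rY _)); rewrite /c ler_peMl// ler1n.
  have t0 : 0 < s / p%:R by rewrite divr_gt0.
  have := psd_remainder_le p sX pX t0.
  rewrite -/r.
  have -> : W om - G om =
      (r / (s / p%:R) ^+ 2) *: (p%:R^-1 *: Y (x i om)) ^+ 2 -
      remainder p (p%:R^-1 *: Y (x i om)).
    rewrite /remainder (scalerA p%:R p%:R^-1) divff ?gt_eqF// scale1r -/(G om).
    rewrite /W /Y -/(Z om) scalerA !expr2 -scaleMl -scaleMr !scalerA.
    have -> : r / (s / p%:R * (s / p%:R)) * (p%:R^-1 * s) * (p%:R^-1 * s) = r.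
      by field; rewrite !gt_eqF.
    set a := r *: _; set b := s *: _; set g := G om.
    rewrite !opprB [in RHS]addrA [RHS]addrA.
    by congr (_ - _); rewrite [LHS]addrC [1 + b]addrC addrA.
  apply.
  have -> : (s / p%:R) *: (1 : 'M[R]_q) - p%:R^-1 *: Y (x i om) =
      (s / p%:R) *: ((1 - D) + A (x i om)).
    rewrite /Y !scalerA [p%:R^-1 * s]mulrC -scalerBr; congr (_ *: _).
    by rewrite opprB addrA addrAC.
  apply: psdZ; first exact: ltW.
  apply: psdD => // y.
  rewrite qformB subr_ge0 qform1E qformE; apply: ler_sum => a _.
  rewrite (bigD1 a)//= big1 ?addr0; last first.
    by move=> b ba; rewrite !mxE eq_sym (negbTE ba) mulr0 mul0r.
  rewrite !mxE eqxx mulr1n mulrAC -expr2 ler_piMr ?sqr_ge0//.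
  by case/andP: (dd01 a).
have := psdD pWG (psdZ r0 pZ).
have b1 : bmeas_mx (fun _ : Omega => 1 : 'M[R]_q) by exact: bmeas_mx_cst.
rewrite (mean_mxB P bW bG) /W (mean_mxD P bW1 bW2) (mean_mxD P b1 bYx).
rewrite mean_mx_cst mean_mx_step addr0 (mean_mxZ P r (bmeas_mxX 2 bZ)).
rewrite scalerBr scalerA [r * K]mulrC -/kappa -/G.
set a := mean_mx P G; set b := r *: _; set e := kappa *: _.
have -> // : 1 + b - a + (e - b) = 1 + e - a.
by rewrite [e - b]addrC addrA [1 + b - a]addrAC addrK addrAC.
Qed.

Lemma partial_sumS (j : 'I_m) om : S j.+1 om = S j om + Y (x j om).
Proof.
rewrite /S (bigD1 j)//= addrC; congr (_ + _); apply: eq_bigl => i.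
by rewrite ltnS ltn_neqAle andbC.
Qed.

Lemma mean_mx_partial_sum j : mean_mx P (S j) = 0.
Proof.
apply/matrixP => a b; rewrite !mxE.
under eq_fun do rewrite summxE.
rewrite (@mean_sum _ _ _ P _ _ _ (fun i om => Y (x i om) a b)); last first.
  by move=> i; exact: (bmeas_mx_rv i bmeas_mx_step a b).
rewrite big1// => i _.
by have := congr1 (fun M : 'M[R]_q => M a b) (mean_mx_step i); rewrite !mxE.
Qed.

Let F j om := remainder p (p%:R^-1 *: S j om).

Lemma potentialE j om : F j om = B j om ^+ p - 1 - S j om.
Proof. by rewrite /F /remainder (scalerA p%:R) divff ?gt_eqF// scale1r. Qed.

Lemma bmeas_potential j : bmeas_mx (F j).
Proof.
have -> : F j = (fun om => (B j om ^+ p - 1) - S j om).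
  by apply/funext => om; rewrite potentialE.
apply: bmeas_mxB; last exact: bmeas_partial_sum.
by apply: bmeas_mxB; [exact/bmeas_mxX/bmeas_base|exact: bmeas_mx_cst].
Qed.

Lemma psd_potential j om : psd (F j om).
Proof.
apply: psd_remainder; first exact/symZ/sym_partial_sum.
apply: psd_1D; [exact: sym_partial_sum|exact: row_bound_partial_sum].
Qed.

Let h j := mean P (fun om => \tr (F j om)).

Lemma mean_tr_base j : \tr (mean_mx P (fun om => B j om ^+ p)) = h j + q%:R.
Proof.
have bB : bmeas_mx (fun om => B j om ^+ p) by exact/bmeas_mxX/bmeas_base.
rewrite /h mean_tr; last exact: bmeas_potential.
have -> : mean_mx P (F j) = mean_mx P (fun om => B j om ^+ p) - 1.
  have -> : F j = (fun om => (B j om ^+ p - 1) - S j om).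
    by apply/funext => om; rewrite potentialE.
  rewrite mean_mxB; last exact: bmeas_partial_sum; last first.
    by apply: bmeas_mxB => //; exact: bmeas_mx_cst.
  by rewrite mean_mxB//; [rewrite mean_mx_cst mean_mx_partial_sum subr0|exact: bmeas_mx_cst].
by rewrite linearB/= mxtrace1 subrK.
Qed.

(** Centering is what makes the bound dimension free: [S] has mean zero, so the
    trace against [D] only sees [D] itself and the remainder. *)
Lemma mean_tr_base_mul j :
  \tr (mean_mx P (fun om => B j om ^+ p) * D) <= \tr D + h j.
Proof.
have bB : bmeas_mx (fun om => B j om ^+ p) by exact/bmeas_mxX/bmeas_base.
have -> : mean_mx P (fun om => B j om ^+ p) = mean_mx P (F j) + 1.
  have -> : (fun om => B j om ^+ p) = (fun om => F j om + (1 + S j om)).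
    by apply/funext => om; rewrite potentialE -[_ - 1 - _]addrA -opprD subrK.
  have b1 : bmeas_mx (fun _ : Omega => 1 : 'M[R]_q) by exact: bmeas_mx_cst.
  have bS := bmeas_partial_sum j.
  rewrite (mean_mxD P (bmeas_potential j) (bmeas_mxD b1 bS)) (mean_mxD P b1 bS).
  by rewrite mean_mx_cst mean_mx_partial_sum addr0.
rewrite mulrDl mul1r linearD/= addrC lerD2l /h mean_tr; last exact: bmeas_potential.
rewrite -[_ * D]/(_ *m D) mul_mx_diag /mxtrace; apply: ler_sum => a _.
rewrite mxE ler_piMr//; last by case/andP: (dd01 a).
by apply: psd_diag_ge0; apply: psd_mean_mx; [exact: bmeas_potential|exact: psd_potential].
Qed.

Let eta := q%:R * c ^+ 2 * expR (2 * c + 2 * c ^+ 2) / p%:R.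

(** One application of the discrete Golden-Thompson inequality; the error
    [eta] is [O(1 / p)]. *)
Lemma potential_step (j : 'I_m) :
  h j.+1 <= (1 + kappa) * h j + kappa * \tr D + eta.
Proof.
pose G t := (1 + p%:R^-1 *: Y t) ^+ p.
have bG : bmeas_mx G by exact/bmeas_mxX/bmeas_mxD/bmeas_mxZ/bmeas_mx_step/bmeas_mx_cst.
have bB j' : bmeas_mx (fun om => B j' om ^+ p) by exact/bmeas_mxX/bmeas_base.
have bGx := bmeas_mx_rv j bG.
set EB := mean_mx P (fun om => B j om ^+ p).
set EG := mean_mx P (fun om => G (x j om)).
have kappa0 := kappa_ge0.
have step1 : h j.+1 + q%:R <= \tr (EB * EG) + eta.
  have -> : EB * EG = mean_mx P (fun om => B j om ^+ p * G (x j om)).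
    apply/matrixP => a b; rewrite !mxE; under [in RHS]eq_fun do rewrite mxE.
    rewrite mean_sum; last by move=> l; exact: bmeasM (bB j _ _) (bGx _ _).
    apply: eq_bigr => l _; rewrite !mxE.
    rewrite (mean_past_mul ind (f := fun om => (B j om ^+ p) a l) _ (bG l b))//.
    have bp := @bmeas_mxX _ (past x j) R q (B j) p (past_base j).
    exact: bp.
  rewrite -mean_tr_base -!mean_tr//; [|exact: bmeas_mxM].
  rewrite -(mean_cst P eta) -meanD; [|exact/bmeas_tr/bmeas_mxM|exact: bmeas_cst].
  apply: mean_le; [exact: bmeas_tr| |move=> om].
    by apply: bmeasD (bmeas_cst _); exact/bmeas_tr/bmeas_mxM.
  rewrite /B partial_sumS; apply: golden_thompson_pow2 pE => //.
  - exact: sym_partial_sum.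
  - exact: sym_step.
  - exact: row_bound_partial_sum.
  - apply: (row_boundW _ (rY _)); rewrite /c ler_peMl// ler1n.
    exact: leq_ltn_trans (leq0n _) (ltn_ord j).
have step2 : \tr (EB * EG) <= \tr EB + kappa * \tr (EB * D).
  have := psd_tr_ge0 (_ : psd (mean_mx P (fun om => B j om ^+ (2 ^ k) *
    (1 + kappa *: D - EG) * B j om ^+ (2 ^ k)))).
  have bBk : bmeas_mx (fun om => B j om ^+ (2 ^ k)) by exact/bmeas_mxX/bmeas_base.
  set Q := 1 + _ - _.
  have bQ : bmeas_mx (fun om => B j om ^+ (2 ^ k) * Q).
    by apply: bmeas_mxM => //; exact: bmeas_mx_cst.
  have bQB : bmeas_mx (fun om => B j om ^+ (2 ^ k) * Q * B j om ^+ (2 ^ k)).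
    exact: bmeas_mxM.
  have -> : \tr (mean_mx P (fun om => B j om ^+ (2 ^ k) * Q * B j om ^+ (2 ^ k))) =
      \tr (EB * Q).
    rewrite /EB -mean_mx_mulr// -!mean_tr//; last first.
      by apply: bmeas_mxM => //; exact: bmeas_mx_cst.
    congr (mean P _); apply/funext => om.
    by rewrite mxtraceC mulrA -exprD addnn -mul2n -expnS -pE.
  have pQ : psd Q by exact: psd_mean_exp.
  move=> /(_ _)/wrap[].
    apply: psd_mean_mx => // om; apply: psd_congr_sym => //.
    by apply/symX/symD; [exact: sym1|exact/symZ/sym_partial_sum].
  rewrite /Q mulrBr mulrDr mulr1 -scaleMr linearB/= linearD/= linearZ/=; lra.
have step3 := mean_tr_base_mul j.
have EBh : \tr EB = h j + q%:R by exact: mean_tr_base.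
have step4 := ler_wpM2l kappa0 step3.
apply: (potential_arith step1 step2 EBh step4).
Qed.

Lemma potential_bound : 0 < kappa ->
  h m <= (\tr D + eta / kappa) * expR (m%:R * kappa).
Proof.
move=> kappa0.
have h_ge0 j : 0 <= h j by apply: mean_ge0 => om; exact/psd_tr_ge0/psd_potential.
have eta0 : 0 <= eta.
  by apply: divr_ge0; rewrite ?ler0n// !mulr_ge0 ?sqr_ge0// ?expR_ge0.
have trD0 : 0 <= \tr D.
  by rewrite mxtrace_diag sumr_ge0// => a _; case/andP: (dd01 a).
apply: affine_recursion => //.
  rewrite /h -[RHS](mean_cst P); congr (mean P _); apply/funext => om.
  rewrite potentialE /B /S big_pred0 => [|i]; last by rewrite ltn0.
  by rewrite scaler0 addr0 expr1n subrr subr0 mxtrace0.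
move=> j; have [jm|mj] := ltnP j m; first exact: (potential_step (Ordinal jm)).
have -> : h j.+1 = h j.
  congr (mean P _); apply/funext => om; congr (\tr (remainder _ (_ *: _))).
  rewrite /S; apply: eq_bigl => i.
  by rewrite !(leq_trans (ltn_ord i))// (leq_trans mj).
have := mulr_ge0 (ltW kappa0) (h_ge0 j).
have := mulr_ge0 (ltW kappa0) trD0; lra.
Qed.

(** Markov's inequality for the trace of the remainder of the whole sum. *)
Lemma bernstein_tail (tau : R) : 0 < kappa -> 0 < tau ->
  let level := scalar_remainder p (tau / p%:R) in
  0 < level ->
  exists E : set Omega, [/\ measurable E,
    (P E <= ((\tr D + eta / kappa) * expR (m%:R * kappa) / level)%:E)%E &
    forall om, ~ E om -> forall y,
      qform (\sum_(i < m) Y (x i om)) y <= tau * qform 1 y].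
Proof.
move=> kappa0 tau0 level level0.
have F0 om : 0 <= \tr (F m om) by exact/psd_tr_ge0/psd_potential.
have [mE PE] := markov_bmeas P (bmeas_tr (@bmeas_potential m)) F0 level0.
exists [set om | level <= \tr (F m om)]; split => //.
  apply: le_trans PE _; rewrite lee_fin ler_pM2r ?invr_gt0//.
  exact: potential_bound.
move=> om /negP; rewrite -ltNge => Fl y; rewrite leNgt; apply/negP => Sy.
have SmE : \sum_(i < m) Y (x i om) = S m om.
  by rewrite /S; apply: eq_bigl => i; rewrite ltn_ord.
rewrite SmE in Sy.
have y0 : 0 < qform 1 y.
  rewrite lt_neqAle qform1_ge0 andbT eq_sym; apply/negP => /eqP y0.
  have {}y0 : y = 0.
    apply/rowP => a; rewrite !mxE; apply/eqP; rewrite -sqrf_eq0.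
    move/eqP: y0; rewrite qform1E psumr_eq0; last by move=> i _; exact: sqr_ge0.
    by move=> /allP/(_ a); rewrite mem_index_enum; exact.
  by move: Sy; rewrite y0 /qform !mul0mx !mxE mulr0 ltxx.
move: Fl; rewrite ltNge => /negP; apply.
rewrite /level {2}pE /F -pE [X in remainder X _]pE.
rewrite {1}pE; apply: (@scalar_remainder_le_tr _ _ _ _ y) => //.
- exact/symZ/sym_partial_sum.
- apply: psd_1D; [exact: sym_partial_sum|exact: row_bound_partial_sum].
- by rewrite divr_ge0// ltW.
- by rewrite qformZ mulrAC mulrC ler_pM2l ?invr_gt0// ltW.
Qed.

End steps.

(** The exponent is optimised by [s = (1/2) / (K + 1/6)], for which [m kappa
    <= tau / 2] with [tau = s m / 2] and [tau / 2 >= ln (4 tr D / delta)]. The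
    trace of the remainder is then large with probability at most [tr D exp
    (tau / 2) / exp tau] times a constant; the factor 4 covers that constant
    and all the losses due to finite [p]. *)
Theorem matrix_bernstein_lower (delta : R) : 0 < delta -> delta <= \tr D ->
  (8 * K + 4 / 3) * ln (4 * \tr D / delta) <= m%:R ->
  exists E : set Omega, [/\ measurable E, (P E <= delta%:E)%E &
    forall om, ~ E om -> forall y,
      m%:R * (qform D y - 1 / 2 * qform 1 y) <= qform (\sum_(i < m) A (x i om)) y].
Proof.
have K0' := K0.
move=> delta0 deltaD mL; set L := ln _ in mL.
have trD0 : 0 < \tr D by exact: lt_le_trans deltaD.
have ratio : 4 <= 4 * \tr D / delta by rewrite ler_pdivlMr// ler_pM2l.
have expL : expR L = 4 * \tr D / delta by rewrite /L lnK// posrE (lt_le_trans _ ratio).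
have L0 : 0 < L by rewrite /L ln_gt0// (lt_le_trans _ ratio)// ltr1n.
pose s := (1 / 2) / (K + 1 / 6).
have K60 : 0 < K + 1 / 6 by lra.
have s0 : 0 < s by rewrite divr_gt0//; lra.
pose tau := s * m%:R / 2.
have tauE : (8 * K + 4 / 3) * (tau / 2) = m%:R.
  rewrite /tau /s; field; rewrite gt_eqF//; lra.
have tauL : L <= tau / 2 by rewrite -(ler_pM2l (_ : 0 < 8 * K + 4 / 3)) ?tauE//; lra.
have tau0 : 0 < tau by lra.

have [c0 c00 rY] := bmeas_mx_row_bound (bmeas_mx_step s).
pose c := m%:R * c0.
have c_ge0 : 0 <= c by rewrite mulr_ge0.
pose C := q%:R * c ^+ 2 * expR (2 * c + 2 * c ^+ 2).
have C0 : 0 <= C by rewrite /C !mulr_ge0 ?sqr_ge0// ?expR_ge0.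
pose kappa0 := K * (s ^+ 2 / 4).
have kappa00 : 0 < kappa0 by rewrite mulr_gt0// divr_gt0// exprn_gt0.
(* The dyadic power has to exceed three thresholds: for the positivity of
   [1 + S / p], for the approximation of [exp tau], and for the error [eta]. *)
pose big := c + 8 * tau ^+ 2 + 2 * C / (kappa0 * \tr D).
have big_ge0 : 0 <= 2 * C / (kappa0 * \tr D).
  by apply: divr_ge0; [rewrite mulr_ge0|rewrite ltW// mulr_gt0].
pose k := Num.bound big.
have [p pE] : exists p, p = (2 ^ k.+1)%N by exists (2 ^ k.+1)%N.
have bigp : big <= p%:R.
  have big0 : 0 <= big by rewrite !addr_ge0// mulr_ge0// sqr_ge0.
  apply: le_trans (ltW (Num.Theory.archi_boundP big0)) _.
  by rewrite ler_nat pE expnS (leq_trans (ltnW (ltn_expl k (ltnSn 1))))// leq_pmull.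
have tau2 : 0 <= 8 * tau ^+ 2 by rewrite mulr_ge0 ?sqr_ge0.
have cp : c <= p%:R by apply: le_trans bigp; rewrite /big; lra.
have taup : 8 * tau ^+ 2 <= p%:R by apply: le_trans bigp; rewrite /big; lra.
have Cp : 2 * C / (kappa0 * \tr D) <= p%:R by apply: le_trans bigp; rewrite /big; lra.
have p2 : 2 <= p%:R :> R by rewrite ler_nat pE expnS leq_pmulr// expn_gt0.
have p0 : 0 < p%:R :> R by lra.
pose kappa := K * scalar_remainder p (s / p%:R).
have psE : p%:R * (s / p%:R) = s by rewrite mulrC divfK// gt_eqF.
have sp0 : 0 <= s / p%:R by rewrite divr_ge0// ltW.
have kappaL : kappa0 <= kappa.
  rewrite /kappa /kappa0 ler_pM2l//; apply: le_trans (scalar_remainder_ge p sp0).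
  have -> : p%:R * (p%:R - 1) / 2 * (s / p%:R) ^+ 2 =
      s ^+ 2 / 4 * (2 - 2 / p%:R) by field; rewrite gt_eqF.
  have s4 : 0 <= s ^+ 2 / 4 by apply: divr_ge0 => //; exact: sqr_ge0.
  have ip : 2 / p%:R <= 1 :> R by rewrite ler_pdivrMr// mul1r.
  apply: ler_peMr => //.
  by rewrite lerBrDr -lerBrDl (le_trans ip)//; lra.
have kappa_gt0 : 0 < kappa by exact: lt_le_trans kappaL.
have kappaU : kappa <= s / 4.
  have s3 : s < 3 by rewrite /s ltr_pdivrMr//; lra.
  have := scalar_remainder_bernstein (p := p) sp0; rewrite psE => /(_ s3).
  rewrite -(ler_pM2l K0) => /le_trans; apply.
  rewrite le_eqVlt; apply/orP; left; apply/eqP.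
  by rewrite /s; field; rewrite !gt_eqF//; lra.
have level : 3 / 8 * expR tau <= scalar_remainder p (tau / p%:R).
  have := expR_le_exp1Dx (ltW tau0) (_ : (0 < p)%N) taup.
  rewrite /scalar_remainder [p%:R * _]mulrC divfK ?gt_eqF//.
  rewrite {1}pE expn_gt0 => /(_ isT).
  have : 4 * expR (tau / 2) <= expR tau.
    have -> : expR tau = expR (tau / 2) * expR (tau / 2).
      by rewrite -expRD; congr expR; lra.
    apply: ler_wpM2r; first exact: expR_ge0.
    by apply: (le_trans ratio); rewrite -expL ler_expR; exact: tauL.
  have := expR_ge1Dx (tau / 2).
  set X := _ ^+ p; lra.
have level0 : 0 < scalar_remainder p (tau / p%:R).
  by apply: lt_le_trans level; rewrite mulr_gt0 ?expR_gt0//; lra.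
have [E [mE PE HE]] :=
  bernstein_tail s0 pE c00 rY cp kappa_gt0 tau0 level0.
exists E; split => //.
  apply: le_trans PE _; rewrite lee_fin ler_pdivrMr//.
  apply: le_trans (ler_wpM2l (ltW delta0) level).
  rewrite -/c -/C -/kappa.
  have eta_le : C / p%:R / kappa <= \tr D / 2.
    move: Cp; rewrite (ler_pdivrMr _ _ (mulr_gt0 kappa00 trD0)) => Cp.
    rewrite ler_pdivrMr// ler_pdivrMr//.
    have : kappa0 * (\tr D * p%:R) <= kappa * (\tr D * p%:R).
      by rewrite ler_wpM2r// mulr_ge0// ltW.
    by lra.
  have exp_le : expR (m%:R * kappa) <= expR (tau / 2).
    rewrite ler_expR /tau.
    have := ler_wpM2l (ler0n R m) kappaU; lra.
  apply: (@le_trans _ _ (3 / 2 * \tr D * expR (tau / 2))).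
    apply: ler_pM; rewrite ?expR_ge0//; last by lra.
    by rewrite addr_ge0// ?divr_ge0// ltW.
  have expD : 4 * \tr D <= delta * expR (tau / 2).
    by rewrite [leRHS]mulrC -ler_pdivrMr// -expL ler_expR.
  have -> : expR tau = expR (tau / 2) * expR (tau / 2).
    by rewrite -expRD; congr expR; lra.
  have := ler_wpM2r (expR_ge0 (tau / 2)) expD; set e := expR _; lra.
move=> om /HE {}HE y; move: (HE y).
rewrite -scaler_sumr qformZ sumrB qformB sumr_const card_ord -scaler_nat qformZ.
rewrite /tau => H.
have : s * (m%:R * qform D y - qform (\sum_(i < m) A (x i om)) y) <=
    s * (m%:R / 2 * qform 1 y) by lra.
rewrite ler_pM2l//; lra.
Qed.

End matrix_bernstein.

(** * Complex vectors in real coordinates *)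

Section complex_parts.
Context {R : realType}.
Implicit Types z t : R[i].

Local Notation Re := complex.Re.
Local Notation Im := complex.Im.

Lemma cabs_sqr z : cabs z ^+ 2 = Re z ^+ 2 + Im z ^+ 2.
Proof.
by case: z => a b; rewrite /cabs /Normc.normc sqr_sqrtr// addr_ge0 ?sqr_ge0.
Qed.

Lemma cabs_ge0 z : 0 <= cabs z.
Proof. by case: z => a b; exact: sqrtr_ge0. Qed.

Lemma cReD z t : Re (z + t) = Re z + Re t. Proof. by case: z t => ? ? []. Qed.
Lemma cImD z t : Im (z + t) = Im z + Im t. Proof. by case: z t => ? ? []. Qed.
Lemma cReM z t : Re (z * t) = Re z * Re t - Im z * Im t.
Proof. by case: z t => ? ? []. Qed.
Lemma cImM z t : Im (z * t) = Re z * Im t + Im z * Re t.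
Proof. by case: z t => ? ? []. Qed.
Lemma cReJ z : Re (conjc z) = Re z. Proof. by case: z. Qed.
Lemma cImJ z : Im (conjc z) = - Im z. Proof. by case: z. Qed.

Lemma cRe_sum I (r : seq I) (P : pred I) (F : I -> R[i]) :
  Re (\sum_(i <- r | P i) F i) = \sum_(i <- r | P i) Re (F i).
Proof. by elim/big_rec2: _ => //= i a b _ <-; rewrite cReD. Qed.

Lemma cIm_sum I (r : seq I) (P : pred I) (F : I -> R[i]) :
  Im (\sum_(i <- r | P i) F i) = \sum_(i <- r | P i) Im (F i).
Proof. by elim/big_rec2: _ => //= i a b _ <-; rewrite cImD. Qed.

Lemma mul_conjc z : z * conjc z = ((cabs z ^+ 2)%:C)%C.
Proof.
apply/eqP; rewrite eq_complex cReM cImM cReJ cImJ cabs_sqr/=.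
by apply/andP; split; apply/eqP; ring.
Qed.

End complex_parts.

Section bessel.
Context {R : realType} {n : nat}.
Implicit Types c d : 'cV[R[i]]_n.

Lemma cdotDl c d e : cdot (c + d) e = cdot c e + cdot d e.
Proof.
by rewrite /cdot -big_split; apply: eq_bigr => i _; rewrite mxE mulrDl.
Qed.

Lemma cdotZl (a : R[i]) c d : cdot (a *: c) d = a * cdot c d.
Proof.
by rewrite /cdot mulr_sumr; apply: eq_bigr => i _; rewrite mxE mulrA.
Qed.

Lemma cdotC c d : cdot c d = conjc (cdot d c).
Proof.
rewrite /cdot rmorph_sum; apply: eq_bigr => i _.
by rewrite rmorphM/= conjcK mulrC.
Qed.

Lemma cdot_suml I (r : seq I) (F : I -> 'cV[R[i]]_n) d :
  cdot (\sum_(i <- r) F i) d = \sum_(i <- r) cdot (F i) d.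
Proof.
elim/big_rec2: _ => [|i y c _ <-]; last by rewrite cdotDl.
by rewrite /cdot big1// => j _; rewrite mxE mul0r.
Qed.

Lemma l2norm_sqr c : l2norm c ^+ 2 = \sum_i cabs (c i ord0) ^+ 2.
Proof. by rewrite sqr_sqrtr// sumr_ge0// => i _; exact: sqr_ge0. Qed.

Lemma cdot_self c : cdot c c = ((l2norm c ^+ 2)%:C)%C.
Proof.
rewrite l2norm_sqr /cdot rmorph_sum; apply: eq_bigr => i _; exact: mul_conjc.
Qed.

Lemma bessel k (v : 'I_k -> 'cV[R[i]]_n) c :
  (forall i j, cdot (v i) (v j) = (i == j)%:R) ->
  \sum_i cabs (cdot c (v i)) ^+ 2 <= l2norm c ^+ 2.
Proof.
move=> ov; pose al i := cdot c (v i).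
pose s := \sum_i al i *: v i.
have cs : cdot c s = ((\sum_i cabs (al i) ^+ 2)%:C)%C.
  rewrite cdotC cdot_suml !rmorph_sum; apply: eq_bigr => i _.
  by rewrite cdotZl rmorphM/= -(cdotC c) -/(al i) mulrC mul_conjc.
have ss : cdot s s = ((\sum_i cabs (al i) ^+ 2)%:C)%C.
  rewrite {1}/s cdot_suml rmorph_sum; apply: eq_bigr => i _.
  rewrite cdotZl [cdot (v i) s]cdotC cdot_suml (bigD1 i)//= big1 => [|j ji].
    by rewrite addr0 cdotZl ov eqxx mulr1 mul_conjc.
  by rewrite cdotZl ov (negbTE ji) mulr0.
have : 0 <= l2norm (c + (-1) *: s) ^+ 2 by exact: sqr_ge0.
have : cdot (c + (-1) *: s) (c + (-1) *: s) =
    ((l2norm c ^+ 2 - \sum_i cabs (al i) ^+ 2)%:C)%C.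
  rewrite cdotDl cdotZl [cdot c _]cdotC [cdot s _]cdotC !cdotDl !cdotZl.
  have sc : cdot s c = ((\sum_i cabs (al i) ^+ 2)%:C)%C.
    by rewrite cdotC cs conjc_real.
  rewrite ss sc cs cdot_self.
  by apply/eqP; rewrite eq_complex/=; apply/andP; split; apply/eqP; ring.
by rewrite cdot_self => /complexI ->; rewrite subr_ge0.
Qed.

End bessel.

(** Only [t > e] matters, and then [((t - e) / 2)^2 <= (t^2 - e^2) / 2].  With a
    factor larger than [1 / 2] in the hypothesis the conclusion would fail for [t]
    slightly above [e]. *)
Lemma half_sum_le (R : realFieldType) (t e s : R) :
  0 <= t -> 0 <= e -> 0 <= s -> t ^+ 2 - 1 / 2 * (t ^+ 2 + e ^+ 2) <= s ^+ 2 ->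
  1 / 2 * (t + e) <= s + e.
Proof.
move=> t0 e0 s0 H; have [te|et] := leP t e; first by lra.
suff : (t - e) / 2 <= s by lra.
rewrite -(@ler_pXn2r _ 2)// ?nnegrE; [|lra..].
apply: le_trans H; rewrite -subr_ge0.
have -> : t ^+ 2 - 1 / 2 * (t ^+ 2 + e ^+ 2) - ((t - e) / 2) ^+ 2 =
  (t - e) * (t + 3 * e) / 4 by field.
by rewrite divr_ge0// mulr_ge0//; lra.
Qed.

Section realification.
Context {R : realType} {r : nat}.
Variable ratio : 'I_r -> R.
Hypothesis ratio0 : forall i, 0 <= ratio i.
Implicit Types z y : 'I_r -> R[i].

Local Notation Re := complex.Re.
Local Notation Im := complex.Im.

Definition re_part z : 'rV[R]_r := \row_i (Num.sqrt (ratio i) * Re (z i)).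
Definition im_part z : 'rV[R]_r := \row_i (Num.sqrt (ratio i) * Im (z i)).
Definition frame1 z : 'rV[R]_(r + r) := row_mx (re_part z) (- im_part z).
Definition frame2 z : 'rV[R]_(r + r) := row_mx (im_part z) (re_part z).

(** The real form of the rank-one Hermitian matrix of [z]: its quadratic form at
    the real and imaginary parts of [y] is the squared modulus of
    [\sum_i sqrt (ratio i) * y i * z i]. *)
Definition frame_mx z : 'M[R]_(r + r) :=
  (frame1 z)^T *m frame1 z + (frame2 z)^T *m frame2 z.

Definition real_coords y : 'rV[R]_(r + r) :=
  row_mx (\row_i Re (y i)) (\row_i Im (y i)).

Definition weight_sum z : R := \sum_i ratio i * cabs (z i) ^+ 2.

Lemma weight_sumE z :
  weight_sum z = \sum_i (re_part z 0 i ^+ 2 + im_part z 0 i ^+ 2).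
Proof.
apply: eq_bigr => i _; rewrite cabs_sqr !mxE !exprMn sqr_sqrtr//; ring.
Qed.

Lemma sym_frame_mx z : sym (frame_mx z).
Proof. by rewrite /sym linearD/= !trmx_mul !trmxK. Qed.

Lemma dot_row q (f g : 'rV[R]_q) : f *m g^T = (\sum_i f 0 i * g 0 i)%:M.
Proof.
apply/rowP => j; rewrite !mxE ord1 eqxx mulr1n; apply: eq_bigr => i _.
by rewrite mxE.
Qed.

Lemma frame11 z : frame1 z *m (frame1 z)^T = (weight_sum z)%:M.
Proof.
rewrite dot_row big_split_ord/= weight_sumE -big_split; congr (_%:M).
by apply: eq_bigr => i _ /=; rewrite row_mxEl row_mxEr !mxE; ring.
Qed.

Lemma frame22 z : frame2 z *m (frame2 z)^T = (weight_sum z)%:M.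
Proof.
rewrite dot_row big_split_ord/= weight_sumE -big_split; congr (_%:M).
by apply: eq_bigr => i _ /=; rewrite !row_mxEl !row_mxEr; ring.
Qed.

Lemma frame12 z : frame1 z *m (frame2 z)^T = 0.
Proof.
rewrite dot_row big_split_ord/= -big_split/= big1 ?scalar_mx0//.
  by rewrite raddf0.
by move=> i _; rewrite !row_mxEl !row_mxEr !mxE; ring.
Qed.

(** The two real rows of a complex vector are orthogonal and have the same
    length, so the real form of a rank-one Hermitian matrix is still a
    multiple of a projection. *)
Lemma frame_mx_sqr z : frame_mx z ^+ 2 = weight_sum z *: frame_mx z.
Proof.
have frame21 : frame2 z *m (frame1 z)^T = 0.
  by rewrite -[LHS]trmxK trmx_mul trmxK frame12 trmx0.
have sandwich (f g h l : 'rV[R]_(r + r)) : f^T *m g *m (h^T *m l) =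
    f^T *m (g *m h^T) *m l by rewrite !mulmxA.
rewrite expr2 -[LHS]/(frame_mx z *m frame_mx z) /frame_mx.
rewrite mulmxDl !mulmxDr !sandwich frame11 frame12 frame21 frame22.
rewrite !mulmx0 !mul0mx addr0 add0r !mul_mx_scalar -!scalemxAl -scalerDr.
by [].
Qed.

Lemma qform_outer q (f y : 'rV[R]_q) :
  qform (f^T *m f) y = (\sum_i f 0 i * y 0 i) ^+ 2.
Proof.
rewrite /qform mulmxA -mulmxA !dot_row -scalar_mxM mxE eqxx mulr1n expr2.
by congr (_ * _); apply: eq_bigr => i _; rewrite mulrC.
Qed.

Lemma psd_frame_mx z : psd (frame_mx z).
Proof. by move=> y; rewrite qformD !qform_outer addr_ge0// sqr_ge0. Qed.

Lemma qform_frame_mx z y : qform (frame_mx z) (real_coords y) =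
  cabs (\sum_i ((Num.sqrt (ratio i))%:C)%C * y i * z i) ^+ 2.
Proof.
rewrite qformD !qform_outer cabs_sqr cRe_sum cIm_sum !big_split_ord/= -!big_split/=.
congr (_ ^+ 2 + _ ^+ 2); apply: eq_bigr => i _.
  by rewrite !row_mxEl !row_mxEr !mxE !(cReM, cImM)/=; ring.
by rewrite !row_mxEl !row_mxEr !mxE !(cReM, cImM)/=; ring.
Qed.

Lemma qform1_real_coords y : qform 1 (real_coords y) = \sum_i cabs (y i) ^+ 2.
Proof.
rewrite qform1E big_split_ord/= -big_split/=; apply: eq_bigr => i _.
by rewrite row_mxEl row_mxEr !mxE cabs_sqr.
Qed.

Definition ratio_row : 'rV[R]_(r + r) :=
  row_mx (\row_i ratio i) (\row_i ratio i).

Lemma qform_diag q (dd y : 'rV[R]_q) :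
  qform (diag_mx dd) y = \sum_i dd 0 i * y 0 i ^+ 2.
Proof.
rewrite /qform mul_mx_diag mxE; apply: eq_bigr => i _.
by rewrite !mxE; ring.
Qed.

Lemma qform_ratio_row y :
  qform (diag_mx ratio_row) (real_coords y) = \sum_i ratio i * cabs (y i) ^+ 2.
Proof.
rewrite qform_diag big_split_ord/= -big_split/=; apply: eq_bigr => i _.
by rewrite !row_mxEl !row_mxEr !mxE cabs_sqr mulrDr.
Qed.

Lemma tr_ratio_row : \tr (diag_mx ratio_row) = 2 * \sum_i ratio i.
Proof.
rewrite mxtrace_diag big_split_ord/= -big_split/= mulr_sumr; apply: eq_bigr => i _.
by rewrite row_mxEl row_mxEr !mxE; ring.
Qed.

Lemma weight_sum_ge0 z : 0 <= weight_sum z.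
Proof. by apply: sumr_ge0 => i _; rewrite mulr_ge0// sqr_ge0. Qed.

Lemma frame_mxE z a b : frame_mx z a b =
  frame1 z 0 a * frame1 z 0 b + frame2 z 0 a * frame2 z 0 b.
Proof.
have outer (f : 'rV[R]_(r + r)) : (f^T *m f) a b = f 0 a * f 0 b.
  by rewrite mxE big_ord1 mxE.
by rewrite [LHS]mxE !outer.
Qed.

Lemma frame_mx_entry z a b : `|frame_mx z a b| <= 2 * weight_sum z.
Proof.
have entry (f : 'rV[R]_(r + r)) c : f *m f^T = (weight_sum z)%:M ->
    f 0 c ^+ 2 <= weight_sum z.
  rewrite dot_row => /(congr1 (fun M : 'M[R]_1 => M 0 0)); rewrite !mxE !eqxx !mulr1n => <-.
  rewrite (bigD1 c)//= expr2 lerDl sumr_ge0// => i _; rewrite -expr2 sqr_ge0//.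
rewrite frame_mxE.
have := entry _ a (frame11 z); have := entry _ b (frame11 z).
have := entry _ a (frame22 z); have := entry _ b (frame22 z).
set k := weight_sum z; set p := frame1 z 0 a; set p' := frame1 z 0 b.
set s := frame2 z 0 a; set s' := frame2 z 0 b => h1 h2 h3 h4.
have := sqr_ge0 (p - p'); have := sqr_ge0 (p + p').
have := sqr_ge0 (s - s'); have := sqr_ge0 (s + s').
rewrite ler_norml => ? ? ? ?; apply/andP; split; lra.
Qed.

End realification.

(** * Orthonormal families in real coordinates *)

Section square_integrable.
Context {d : measure_display} {T : measurableType d} {R : realType}.
Variables (X : set T) (mX : measurable X) (rho : {measure set T -> \bar R}).
Implicit Types f g : T -> R[i].

Local Notation Re := complex.Re.
Local Notation Im := complex.Im.

Lemma measurable_cabs2 f : cmeasurable X f ->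
  measurable_fun X (fun x => cabs (f x) ^+ 2).
Proof.
move=> [mr mi]; under eq_fun do rewrite cabs_sqr.
by apply: measurable_funD; exact: measurable_funX.
Qed.

Lemma Lpnorm2E f : Lpnorm X rho 2%:E (cabs \o f) =
  ((\int[rho]_(x in X) (cabs (f x) ^+ 2)%:E) `^ 2^-1)%E.
Proof.
rewrite /Lpnorm unlock; congr (_ `^ _)%E.
rewrite [RHS]integral_mkcond; apply: eq_integral => x _.
rewrite !patchE; case: ifPn => _.
  by rewrite /= ger0_norm ?cabs_ge0// powR_mulrn ?cabs_ge0.
by rewrite /= normr0 powR0.
Qed.

Lemma in_L2_integrable f : in_L2 X rho f ->
  rho.-integrable X (EFin \o (fun x => cabs (f x) ^+ 2)).
Proof.
move=> [cf]; rewrite Lpnorm2E => /lty_poweRy h.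
apply/integrableP; split; first exact/measurable_EFinP/measurable_cabs2.
under eq_integral do rewrite /= ger0_norm ?sqr_ge0//.
by apply: h; rewrite invr_neq0.
Qed.

Lemma cabs_sqr_abs_Re (z t : R[i]) :
  `|Re (z * conjc t)| <= cabs z ^+ 2 + cabs t ^+ 2.
Proof.
rewrite cReM cReJ cImJ !cabs_sqr ler_norml.
set a := Re z; set b := Im z; set c := Re t; set e := Im t.
have := sqr_ge0 (a - c); have := sqr_ge0 (a + c).
have := sqr_ge0 (b - e); have := sqr_ge0 (b + e).
have := sqr_ge0 a; have := sqr_ge0 b; have := sqr_ge0 c; have := sqr_ge0 e.
by move=> *; apply/andP; split; lra.
Qed.

Lemma cabs_sqr_abs_Im (z t : R[i]) :
  `|Im (z * conjc t)| <= cabs z ^+ 2 + cabs t ^+ 2.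
Proof.
rewrite cImM cReJ cImJ !cabs_sqr ler_norml.
set a := Re z; set b := Im z; set c := Re t; set e := Im t.
have := sqr_ge0 (a - e); have := sqr_ge0 (a + e).
have := sqr_ge0 (b - c); have := sqr_ge0 (b + c).
have := sqr_ge0 a; have := sqr_ge0 b; have := sqr_ge0 c; have := sqr_ge0 e.
by move=> *; apply/andP; split; lra.
Qed.

Lemma measurable_Re_mulJ f g : cmeasurable X f -> cmeasurable X g ->
  measurable_fun X (fun x => Re (f x * conjc (g x))).
Proof.
move=> [mfr mfi] [mgr mgi]; under eq_fun do rewrite cReM cReJ cImJ mulrN opprK.
by apply: measurable_funD; exact: measurable_funM.
Qed.

Lemma measurable_Im_mulJ f g : cmeasurable X f -> cmeasurable X g ->
  measurable_fun X (fun x => Im (f x * conjc (g x))).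
Proof.
move=> [mfr mfi] [mgr mgi]; under eq_fun do rewrite cImM cReJ cImJ mulrN addrC.
by apply: measurable_funB; exact: measurable_funM.
Qed.

Lemma integrable_Re_mulJ f g : in_L2 X rho f -> in_L2 X rho g ->
  rho.-integrable X (EFin \o (fun x => Re (f x * conjc (g x)))).
Proof.
move=> L2f L2g.
apply: (le_integrable mX) (integrableD mX (in_L2_integrable L2f) (in_L2_integrable L2g)).
  exact/measurable_EFinP/(measurable_Re_mulJ L2f.1 L2g.1).
move=> x _ /=; rewrite lee_fin [leRHS]ger0_norm ?addr_ge0 ?sqr_ge0//.
exact: cabs_sqr_abs_Re.
Qed.

Lemma integrable_Im_mulJ f g : in_L2 X rho f -> in_L2 X rho g ->
  rho.-integrable X (EFin \o (fun x => Im (f x * conjc (g x)))).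
Proof.
move=> L2f L2g.
apply: (le_integrable mX) (integrableD mX (in_L2_integrable L2f) (in_L2_integrable L2g)).
  exact/measurable_EFinP/(measurable_Im_mulJ L2f.1 L2g.1).
move=> x _ /=; rewrite lee_fin [leRHS]ger0_norm ?addr_ge0 ?sqr_ge0//.
exact: cabs_sqr_abs_Im.
Qed.

Lemma integrable_scale (c : R) (f : T -> R) : rho.-integrable X (EFin \o f) ->
  rho.-integrable X (EFin \o (fun x => c * f x)).
Proof. exact: integrableZl. Qed.

Section orthonormal.
Variables (r : nat) (u : 'I_r -> T -> R[i]) (ratio : 'I_r -> R).
Hypothesis u2 : forall i, in_L2 X rho (u i).
Hypothesis uo : forall i j, L2dot X rho (u i) (u j) = (i == j)%:R.
Hypothesis ratio0 : forall i, 0 <= ratio i.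

Let M x := frame_mx ratio (u^~ x).

(* The four blocks of the matrix, as real or imaginary parts of [u_i u_j^*]. *)
Let entry (a b : 'I_(r + r)) (x : T) : R :=
  match fintype.split a, fintype.split b with
  | inl i, inl j | inr i, inr j =>
      Num.sqrt (ratio i) * Num.sqrt (ratio j) * Re (u i x * conjc (u j x))
  | inl i, inr j =>
      Num.sqrt (ratio i) * Num.sqrt (ratio j) * Im (u i x * conjc (u j x))
  | inr i, inl j =>
      Num.sqrt (ratio i) * Num.sqrt (ratio j) * - Im (u i x * conjc (u j x))
  end.

Lemma frame_entryE a b x : M x a b = entry a b x.
Proof.
rewrite /M frame_mxE /entry /frame1 /frame2 ![row_mx _ _ _ _]mxE.
case: (fintype.split a) => i; case: (fintype.split b) => j;
  by rewrite !mxE !(cReM, cImM) cReJ cImJ; ring.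
Qed.

Lemma integrable_frame a b : rho.-integrable X (EFin \o (fun x => M x a b)).
Proof.
rewrite (_ : (fun x => M x a b) = entry a b); last first.
  by apply/funext => x; exact: frame_entryE.
rewrite /entry; case: (fintype.split a) => i; case: (fintype.split b) => j.
- exact/integrable_scale/integrable_Re_mulJ.
- exact/integrable_scale/integrable_Im_mulJ.
- under eq_fun do rewrite mulrN -mulNr.
  exact/integrable_scale/integrable_Im_mulJ.
- exact/integrable_scale/integrable_Re_mulJ.
Qed.

Lemma Rintegral_frame a b :
  \int[rho]_(x in X) M x a b = diag_mx (ratio_row ratio) a b.
Proof.
have dotRe i j : \int[rho]_(x in X) Re (u i x * conjc (u j x)) = (i == j)%:R.
  have := congr1 (@complex.Re R) (uo i j); rewrite /L2dot/= => ->.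
  by case: (i == j).
have dotIm i j : \int[rho]_(x in X) Im (u i x * conjc (u j x)) = 0.
  have := congr1 (@complex.Im R) (uo i j); rewrite /L2dot/= => ->.
  by case: (i == j).
rewrite (_ : (fun x => M x a b) = entry a b); last first.
  by apply/funext => x; exact: frame_entryE.
rewrite /entry mxE /ratio_row [row_mx _ _ _ _]mxE.
have ab : (a == b) = (unsplit (fintype.split a) == unsplit (fintype.split b)) by rewrite !fintype.splitK.
rewrite ab; case: (fintype.split a) => i; case: (fintype.split b) => j /=.
- rewrite RintegralZl//; last exact: integrable_Re_mulJ.
  rewrite dotRe mxE; have [->|ij] := eqVneq i j.
    by rewrite eqxx mulr1 -expr2 sqr_sqrtr.
  by rewrite (inj_eq (@lshift_inj _ _)) (negbTE ij) mulr0.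
- rewrite RintegralZl//; last exact: integrable_Im_mulJ.
  by rewrite dotIm mulr0 eq_lrshift.
- under eq_Rintegral do rewrite mulrN -mulNr.
  rewrite RintegralZl//; last exact: integrable_Im_mulJ.
  by rewrite dotIm mulr0 eq_rlshift.
- rewrite RintegralZl//; last exact: integrable_Re_mulJ.
  rewrite dotRe mxE; have [->|ij] := eqVneq i j.
    by rewrite eqxx mulr1 -expr2 sqr_sqrtr.
  by rewrite (inj_eq (@rshift_inj _ _)) (negbTE ij) mulr0.
Qed.

End orthonormal.
End square_integrable.

(** * Integration against the sampling measure *)

(** The inverse is assembled from the power function on the positive and
    negative parts, since the power with exponent [-1] vanishes at 0. *)
Lemma measurable_funV {d : measure_display} {T : measurableType d} {R : realType}
    (D : set T) (f : T -> R) :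
  measurable_fun D f -> measurable_fun D (fun x => (f x)^-1).
Proof.
move=> mf.
have -> : (fun x => (f x)^-1) = (fun x =>
    (Num.max (f x) 0) `^ (-1) - (Num.max (- f x) 0) `^ (-1)).
  apply/funext => x; rewrite !powR_inv1 ?le_max ?lexx ?orbT//.
  have [f0|f0] := leP 0 (f x).
    by rewrite max_r ?oppr_le0// invr0 subr0.
  by rewrite invr0 sub0r max_l ?oppr_ge0 1?ltW// invrN opprK.
have mpow (g : T -> R) : measurable_fun D g -> measurable_fun D (fun x => g x `^ (-1)).
  by move=> mg; exact: (measurableT_comp (@measurable_powR R (-1)) mg).
apply: measurable_funB; apply: mpow; apply: measurable_maxr => //.
exact: measurable_funN.
Qed.

Section density.
Context {dT : measure_display} {T : measurableType dT}.
Context {d : measure_display} {Omega : measurableType d} {R : realType}.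
Variables (P : probability Omega R) (xi : {RV P >-> T}).
Variables (X : set T) (rho : probability T R) (w : T -> R).
Hypothesis mX : measurable X.
Hypothesis w_weight : is_weight X rho w.
Hypothesis law : forall A, measurable A ->
  distribution P xi A = sampling_measure X rho w A.

Let g : T -> \bar R := (fun x => ((w x)^-1)%:E) \_ X.

Lemma measurable_weightV : measurable_fun X (fun x => ((w x)^-1)%:E).
Proof.
suff : measurable_fun X (EFin \o (fun x => (w x)^-1)) by [].
by apply/measurable_EFinP/measurable_funV; case: w_weight.
Qed.

Lemma measurable_density : measurable_fun setT g.
Proof.
exact: (measurable_restrictT _ mX).1 measurable_weightV.
Qed.

Lemma sampling_dominated : distribution P xi `<< rho.
Proof.
apply/null_content_dominatesP => A mA A0; rewrite law// /sampling_measure.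
have mAX : measurable (A `&` X) by exact: measurableI.
apply: null_set_integral => //.
  by apply: measurable_funS measurable_weightV => //; exact: subIsetr.
by apply/eqP; rewrite -measure_le0 -A0 le_measure ?inE//; exact: subIsetl.
Qed.

(** Both functions have the same integral over every measurable set, by the
    hypothesis on the law of the sample. *)
Lemma density_ae_eq : ae_eq rho setT
  (Radon_Nikodym (charge_of_finite_measure (distribution P xi)) rho) g.
Proof.
apply: integral_ae_eq => //.
- by apply: Radon_Nikodym_integrable; exact: sampling_dominated.
- exact: measurable_density.
have dom : charge_of_finite_measure (distribution P xi) `<< rho.
  exact: sampling_dominated.
move=> E _ mE; rewrite -(Radon_Nikodym_integral dom)//=.
by rewrite law// /sampling_measure /g integral_mkcondr.
Qed.

(** Integrating against the sampling measure is integrating against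
    [w^-1 d rho]. *)
Lemma mean_sampling (f : T -> R) : bmeas f ->
  mean P (fun om => f (xi om)) = \int[rho]_(x in X) (f x * (w x)^-1).
Proof.
move=> bf.
have ifx : P.-integrable setT ((EFin \o f) \o xi).
  exact: bmeas_integrable (bmeas_comp_rv xi bf).
have inu : (distribution P xi).-integrable setT (EFin \o f).
  exact: (@bmeas_integrable _ _ _ (distribution P xi) f bf).
rewrite /mean /Rintegral; congr fine.
have mf : measurable_fun setT (EFin \o f) by apply/measurable_EFinP; case: bf.
rewrite -(@integral_distribution _ _ _ _ _ P xi (EFin \o f))//.
rewrite -(Radon_Nikodym_change_of_variables sampling_dominated measurableT inu).
transitivity (\int[rho]_x ((EFin \o f) x * g x))%E.
  apply: ae_eq_integral => //.
  - apply: emeasurable_funM => //; apply: measurable_int.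
    apply: Radon_Nikodym_integrable; exact: sampling_dominated.
  - apply: emeasurable_funM => //; exact: measurable_density.
  - apply: ae_eqe_mul2l; exact: density_ae_eq.
rewrite [RHS]integral_mkcond; apply: eq_integral => x _.
by rewrite /g !patchE; case: ifP => _ //=; rewrite mule0.
Qed.

End density.

(** * Measurability of the stability event *)

Section continuity.
Context {R : realType}.

Lemma continuous_qform q (A : 'M[R]_q) : continuous (qform A).
Proof.
have -> : qform A = (fun y => \sum_i \sum_j y 0 i * A i j * y 0 j).
  by apply/funext => y; exact: qformE.
apply: continuous_big => [|i _]; first exact: add_continuous.
apply: continuous_big => [|j _]; first exact: add_continuous.
move=> y; apply: (@continuousM _ _ (fun z : 'rV[R]_q => z 0 i * A i j)
  (fun z => z 0 j)); last exact: coord_continuous.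
apply: (@continuousM _ _ (fun z : 'rV[R]_q => z 0 i) (fun=> A i j)).
  exact: coord_continuous.
exact: cst_continuous.
Qed.

(** Negativity is an open condition, so it would hold at a rational point. *)
Lemma ge0_rational_dense q (h : 'rV[R]_q -> R) : continuous h ->
  (forall y : 'rV[rat]_q, 0 <= h (map_mx ratr y)) -> forall y, 0 <= h y.
Proof.
move=> ch hQ y; rewrite leNgt; apply/negP => hy.
have /nbhs_ballP[e /= e0 he] : nbhs y (h @^-1` [set t | t < 0]).
  by apply: (ch y); exact: lt_nbhsl.
have Q i : exists t : rat, y 0 i - e < ratr t < y 0 i + e.
  have /rat_in_itvoo[t] : y 0 i - e < y 0 i + e by lra.
  by rewrite in_itv/= => ?; exists t.
pose z : 'rV[rat]_q := \row_i sval (cid (Q i)).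
have : ball y e (map_mx ratr z).
  split=> // i j; rewrite ord1 !mxE; case: cid => t /= /andP[h1 h2].
  by rewrite /ball/= ltr_distlC; apply/andP; split; lra.
by move=> /he; rewrite /= ltNge hQ.
Qed.

End continuity.

Section stability_event.
Context {dT : measure_display} {T : measurableType dT}.
Context {d : measure_display} {Omega : measurableType d} {R : realType}.
Variables (P : probability Omega R) (m : nat) (x : 'I_m -> {RV P >-> T}).
Variables (X : set T) (rho : {measure set T -> \bar R}) (w : T -> R).
Variables (n : nat) (phi : 'I_n -> T -> R[i]) (eps : R).
Hypothesis mX : measurable X.
Hypothesis mw : measurable_fun X w.
Hypothesis mphi : forall i, cmeasurable X (phi i).
Hypothesis xX : forall j om, X (x j om).

Lemma cmeasurable_synth c : cmeasurable X (synth phi c).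
Proof.
split; rewrite /synth.
  under eq_fun do rewrite cRe_sum; apply: measurable_sum => i.
  under eq_fun do rewrite cReM.
  by apply: measurable_funB; apply: measurable_funM => //; case: (mphi i).
under eq_fun do rewrite cIm_sum; apply: measurable_sum => i.
under eq_fun do rewrite cImM.
by apply: measurable_funD; apply: measurable_funM => //; case: (mphi i).
Qed.

Lemma measurable_sample j (f : T -> R) : measurable_fun X f ->
  measurable_fun setT (fun om => f (x j om)).
Proof.
move=> mf; apply: (measurable_comp mX) mf (measurable_funP (x j)).
by move=> _ [om _ <-]; exact: xX.
Qed.

Lemma sampling_norm_sqr (f : T -> R[i]) om :
  l2norm (sampling_op w (fun j => x j om) f) ^+ 2 =
  \sum_j Num.sqrt (w (x j om) / m%:R) ^+ 2 * cabs (f (x j om)) ^+ 2.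
Proof.
rewrite l2norm_sqr; apply: eq_bigr => j _; rewrite mxE !cabs_sqr cReM cImM/=.
ring.
Qed.

Lemma measurable_sampling_norm c : measurable_fun setT
  (fun om => l2norm (sampling_op w (fun j => x j om) (synth phi c))).
Proof.
have -> : (fun om => l2norm (sampling_op w (fun j => x j om) (synth phi c))) =
    (fun om => Num.sqrt (\sum_j Num.sqrt (w (x j om) / m%:R) ^+ 2 *
      cabs (synth phi c (x j om)) ^+ 2)).
  apply/funext => om; rewrite -sampling_norm_sqr sqrtr_sqr ger0_norm//.
  exact: sqrtr_ge0.
have msqrt (g : Omega -> R) : measurable_fun setT g ->
    measurable_fun setT (fun om => Num.sqrt (g om)).
  have ms : measurable_fun setT (@Num.sqrt R).
    by apply: continuous_measurable_fun => ?; exact: sqrt_continuous.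
  by move=> mg; exact: (measurableT_comp ms mg).
apply: (msqrt); apply: measurable_sum => j.
apply: measurable_funM.
  apply: measurable_funX; apply: (msqrt); apply: measurable_funM => //.
  exact: measurable_sample.
by apply: (@measurable_sample j (fun t => cabs (synth phi c t) ^+ 2));
  apply: measurable_cabs2; exact: cmeasurable_synth.
Qed.

Let complex_col (y : 'rV[R]_(n + n)) : 'cV[R[i]]_n :=
  \col_i Complex (y 0 (lshift n i)) (y 0 (rshift n i)).

Lemma real_coords_complex_col y :
  real_coords (fun i => complex_col y i ord0) = y.
Proof.
rewrite -[RHS]hsubmxK; congr row_mx; apply/rowP => i; rewrite !mxE//=.
Qed.

Let unit_ratio : 'I_n -> R := fun=> 1.

(** Writing the norms as square roots of quadratic forms in the real coordinates
    of [c] makes their continuity in [c] immediate. *)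
Lemma sampling_norm_qform (c : 'cV[R[i]]_n) om :
  l2norm (sampling_op w (fun j => x j om) (synth phi c)) =
  Num.sqrt (qform (\sum_j Num.sqrt (w (x j om) / m%:R) ^+ 2 *:
    frame_mx unit_ratio (fun i => phi i (x j om)))
    (real_coords (fun i => c i ord0))).
Proof.
rewrite qform_sum -[LHS]ger0_norm ?sqrtr_ge0// -sqrtr_sqr sampling_norm_sqr.
congr Num.sqrt; apply: eq_bigr => j _; rewrite qformZ qform_frame_mx.
congr (_ * cabs _ ^+ 2); apply: eq_bigr => i _.
by rewrite sqrtr1 mul1r.
Qed.

Lemma l2norm_qform (c : 'cV[R[i]]_n) :
  l2norm c = Num.sqrt (qform 1 (real_coords (fun i => c i ord0))).
Proof. by rewrite qform1_real_coords. Qed.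

Variable B : 'M[R]_(n + n).
Hypothesis T_qform : forall c, L2norm X rho (synth phi c) =
  Num.sqrt (qform B (real_coords (fun i => c i ord0))).

Let rat_event (y : 'rV[rat]_(n + n)) : set Omega :=
  let c := complex_col (map_mx ratr y) in
  [set om | 1 / 2 * (L2norm X rho (synth phi c) + eps * l2norm c) <=
    l2norm (sampling_op w (fun j => x j om) (synth phi c)) + eps * l2norm c].

(** Both sides are continuous in [c], so countably many [c] suffice. *)
Lemma measurable_stability_event :
  measurable (stability_event X rho phi eps w x).
Proof.
have -> : stability_event X rho phi eps w x = \bigcap_k
    (if unpickle k is Some y then rat_event y else setT).
  apply/seteqP; split=> om.
    by move=> H k _; case: unpickle => [y|//]; exact: H.
  move=> H c.
  pose h (y : 'rV[R]_(n + n)) : R :=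
    Num.sqrt (qform (\sum_j Num.sqrt (w (x j om) / m%:R) ^+ 2 *:
      frame_mx unit_ratio (fun i => phi i (x j om))) y) +
    eps * Num.sqrt (qform 1 y) -
    1 / 2 * (Num.sqrt (qform B y) + eps * Num.sqrt (qform 1 y)).
  have ch : continuous h.
    have cs A : continuous (fun y : 'rV[R]_(n + n) => Num.sqrt (qform A y)).
      move=> y; apply: (@continuous_comp _ _ _ (qform A) Num.sqrt).
        exact: continuous_qform.
      exact: sqrt_continuous.
    have cz (a : R) (f : 'rV[R]_(n + n) -> R) : continuous f ->
        continuous (fun y => a * f y).
      move=> cf y; apply: (@continuousM _ _ (fun=> a) f); last exact: cf.
      exact: cst_continuous.
    have cd (f g : 'rV[R]_(n + n) -> R) : continuous f -> continuous g ->
        continuous (fun y => f y + g y).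
      by move=> cf cg y; apply: (@continuousD _ _ _ f g); [exact: cf|exact: cg].
    rewrite /h; under eq_fun do rewrite -mulN1r.
    apply: (cd) ; first by apply: (cd); [exact: cs|exact/cz/cs].
    by apply/cz/cz/(cd); [exact: cs|exact/cz/cs].
  have hge : 0 <= h (real_coords (fun i => c i ord0)).
    apply: ge0_rational_dense => // y.
    have := H (pickle y) I; rewrite pickleK /rat_event/=.
    rewrite T_qform l2norm_qform sampling_norm_qform real_coords_complex_col.
    by rewrite /h subr_ge0.
  by rewrite T_qform l2norm_qform sampling_norm_qform -subr_ge0.
apply: bigcapT_measurable => k; case: unpickle => [y|]; last exact: measurableT.
set c := complex_col (map_mx ratr y).
have : measurable_fun setT (fun om =>
    1 / 2 * (L2norm X rho (synth phi c) + eps * l2norm c) <=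
    l2norm (sampling_op w (fun j => x j om) (synth phi c)) + eps * l2norm c).
  apply: measurable_fun_ler => //; apply: measurable_funD => //.
  exact: measurable_sampling_norm.
by move=> /(_ measurableT [set true] I); rewrite setTI.
Qed.

End stability_event.

(** * Stability with high probability *)

Lemma Rintegral_lincomb {d} {T : measurableType d} {R : realType}
    (mu : {measure set T -> \bar R}) (X : set T) (mX : measurable X)
    (I : Type) (s : seq I) (c : I -> R) (f : I -> T -> R) :
  (forall i, mu.-integrable X (EFin \o f i)) ->
  mu.-integrable X (EFin \o (fun x => \sum_(i <- s) c i * f i x)) /\
  \int[mu]_(x in X) (\sum_(i <- s) c i * f i x) =
  \sum_(i <- s) c i * \int[mu]_(x in X) f i x.
Proof.
move=> intf; elim: s => [|i s [IH1 IH2]].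
  rewrite big_nil (_ : (fun x => \sum_(i <- [::]) c i * f i x) = cst 0).
    split; first exact: integrable0.
    by rewrite Rintegral_cst// mul0r.
  by apply/funext => x; rewrite big_nil.
rewrite big_cons (_ : (fun x => \sum_(i <- i :: s) c i * f i x) =
  (fun x => c i * f i x + \sum_(j <- s) c j * f j x)); last first.
  by apply/funext => x; rewrite big_cons.
have ci := integrable_scale mX (c i) (intf i).
split; first exact: (integrableD mX ci IH1).
by rewrite RintegralD// IH2 RintegralZl.
Qed.

Section stability.
Context {dT : measure_display} {T : measurableType dT} {R : realType}.
Variables (X : set T) (mX : measurable X) (rho : probability T R).
Hypothesis rhoX : rho X = 1%E.
Variables (n : nat) (phi : 'I_n -> T -> R[i]).
Hypothesis phi_Linfty : forall i, in_Linfty X rho (phi i).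
Variables (r : nat) (sigma : 'I_r -> R) (u : 'I_r -> T -> R[i])
  (v : 'I_r -> 'cV[R[i]]_n).
Hypothesis svd : is_svd X rho phi sigma u v.
Variable eps : R.
Hypothesis eps0 : 0 < eps.

Let ratio i := sigma i ^+ 2 / (sigma i ^+ 2 + eps ^+ 2).
Let k := k_eps sigma u eps.

Let sigma0 i : 0 < sigma i. Proof. by case: svd => -[]. Qed.
Let u2 i : in_L2 X rho (u i). Proof. by case: svd => _ [/(_ i)[]]. Qed.
Let uo i j : L2dot X rho (u i) (u j) = (i == j)%:R.
Proof. by case: svd => _ []. Qed.
Let vo i j : cdot (v i) (v j) = (i == j)%:R. Proof. by case: svd. Qed.

Let den_gt0 i : 0 < sigma i ^+ 2 + eps ^+ 2.
Proof. by rewrite addr_gt0// exprn_gt0. Qed.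

Let ratio0 i : 0 <= ratio i.
Proof. by apply: divr_ge0; [exact: sqr_ge0|exact: ltW]. Qed.

Let ratio1 i : ratio i <= 1.
Proof. by rewrite ler_pdivrMr// mul1r lerDl sqr_ge0. Qed.

Lemma k_epsE x : k x = weight_sum ratio (u^~ x).
Proof. by []. Qed.

Lemma integral_cabs2_u i :
  \int[rho]_(x in X) (cabs (u i x) ^+ 2) = 1.
Proof.
have := congr1 (@complex.Re R) (uo i i); rewrite eqxx /L2dot/= => <-.
by apply: eq_Rintegral => x _; rewrite mul_conjc.
Qed.

Lemma k_eps_integral :
  rho.-integrable X (EFin \o k) /\ \int[rho]_(x in X) k x = \sum_i ratio i.
Proof.
have [ik Ik] := Rintegral_lincomb mX (index_enum _) ratio
  (fun i => in_L2_integrable (u2 i)).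
split; first exact: ik.
by rewrite Ik; apply: eq_bigr => i _; rewrite integral_cabs2_u mulr1.
Qed.

Let N := n_eps X rho sigma u eps.

Lemma n_epsE : N = \sum_i ratio i.
Proof. exact: k_eps_integral.2. Qed.

Let alpha (c : 'cV[R[i]]_n) i : R[i] := cdot c (v i).
Let coef c i : R[i] := ((Num.sqrt (sigma i ^+ 2 + eps ^+ 2))%:C)%C * alpha c i.

Lemma cabsM_real (a : R) z : cabs ((a%:C)%C * z) ^+ 2 = a ^+ 2 * cabs z ^+ 2.
Proof. by rewrite !cabs_sqr cReM cImM/=; ring. Qed.

Lemma coef_sqr c i :
  cabs (coef c i) ^+ 2 = (sigma i ^+ 2 + eps ^+ 2) * cabs (alpha c i) ^+ 2.
Proof. by rewrite cabsM_real sqr_sqrtr// ltW. Qed.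

Lemma ratio_coef c i :
  (((Num.sqrt (ratio i))%:C)%C * coef c i = ((sigma i)%:C)%C * alpha c i)%R.
Proof.
rewrite /coef mulrA; congr (_ * _); rewrite -rmorphM/=; congr (_%:C)%C.
rewrite -sqrtrM// /ratio divfK ?gt_eqF// sqrtr_sqr ger0_norm//.
exact: ltW.
Qed.

Lemma qform_D_coef c :
  qform (diag_mx (ratio_row ratio)) (real_coords (coef c)) =
  \sum_i sigma i ^+ 2 * cabs (alpha c i) ^+ 2.
Proof.
rewrite qform_ratio_row; apply: eq_bigr => i _.
by rewrite coef_sqr mulrA /ratio divfK// gt_eqF.
Qed.

Lemma qform_1_coef c : qform 1 (real_coords (coef c)) <=
  \sum_i sigma i ^+ 2 * cabs (alpha c i) ^+ 2 + (eps * l2norm c) ^+ 2.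
Proof.
rewrite qform1_real_coords; under eq_bigr do rewrite coef_sqr mulrDl.
rewrite big_split/= lerD2l -mulr_sumr exprMn ler_wpM2l ?sqr_ge0//.
exact: bessel.
Qed.

(** The null set in the decomposition depends on [c]; by linearity the null sets
    of the [n] basis vectors suffice for all [c] at once. *)
Lemma svd_ae : {ae rho, forall x, X x -> forall c,
  synth phi c x = \sum_(i < r) ((Num.sqrt (ratio i))%:C)%C * coef c i * u i x}.
Proof.
pose e l : 'cV[R[i]]_n := delta_mx l 0.
have sae l : ae_on X rho (fun x => synth phi (e l) x =
    \sum_(i < r) ((sigma i)%:C)%C * cdot (e l) (v i) * u i x).
  by case: svd => _ _ _; exact.
have synth_e l x : synth phi (e l) x = phi l x.
  rewrite /synth (bigD1 l)//= big1 ?addr0 ?mxE ?eqxx ?mul1r// => j jl.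
  by rewrite mxE (negbTE jl) mul0r.
have Hall : {ae rho, forall x, forall l, X x -> synth phi (e l) x =
    \sum_(i < r) ((sigma i)%:C)%C * cdot (e l) (v i) * u i x}.
  by apply: filter_forall => l; exact: sae.
apply: filterS Hall => x H Xx c.
transitivity (\sum_(l < n) c l ord0 *
  \sum_(i < r) ((sigma i)%:C)%C * cdot (e l) (v i) * u i x).
  by apply: eq_bigr => l _; rewrite -H// synth_e.
under eq_bigr do rewrite mulr_sumr.
rewrite exchange_big/=; apply: eq_bigr => i _.
rewrite ratio_coef /alpha.
have -> : c = \sum_l c l ord0 *: e l.
  apply/colP => j; rewrite summxE (bigD1 j)//= big1 => [|l lj].
    by rewrite !mxE !eqxx mulr1 addr0.
  by rewrite !mxE eq_sym (negbTE lj) mulr0.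
rewrite cdot_suml mulr_sumr mulr_suml; apply: eq_bigr => l _.
rewrite cdotZl summxE (bigD1 l)//= big1 => [|j jl]; last first.
  by rewrite !mxE eq_sym (negbTE jl) mulr0.
by rewrite !mxE !eqxx mulr1 addr0; ring.
Qed.

Let mphi i : cmeasurable X (phi i). Proof. by case: (phi_Linfty i). Qed.

(** The integral of the form of [frame_mx] at [y] is the form of its integral,
    which is diagonal by orthonormality. *)
Lemma L2norm_synth c : L2norm X rho (synth phi c) =
  Num.sqrt (\sum_i sigma i ^+ 2 * cabs (alpha c i) ^+ 2).
Proof.
pose y := real_coords (coef c).
pose M x := frame_mx ratio (u^~ x).
have iM a b : rho.-integrable X (EFin \o (fun x => M x a b)).
  exact: integrable_frame.
have qformM x : qform (M x) y =
    \sum_(p : 'I_(r + r) * 'I_(r + r)) (y 0 p.1 * y 0 p.2) * M x p.1 p.2.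
  rewrite qformE pair_big/=; apply: eq_bigr => p _; ring.
have [iq Iq] := Rintegral_lincomb mX (index_enum _)
  (fun p : 'I_(r + r) * 'I_(r + r) => y 0 p.1 * y 0 p.2)
  (f := fun p x => M x p.1 p.2) (fun p => iM p.1 p.2).
have {}iq : rho.-integrable X (EFin \o (fun x => qform (M x) y)).
  have -> : (fun x => qform (M x) y) = (fun x =>
      \sum_(p : 'I_(r + r) * 'I_(r + r)) (y 0 p.1 * y 0 p.2) * M x p.1 p.2).
    by apply/funext => x; exact: qformM.
  exact: iq.
have {}Iq : \int[rho]_(x in X) qform (M x) y =
    \sum_i sigma i ^+ 2 * cabs (alpha c i) ^+ 2.
  under eq_Rintegral do rewrite qformM.
  rewrite Iq -qform_D_coef qformE pair_big/=; apply: eq_bigr => p _.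
  by rewrite Rintegral_frame//; ring.
rewrite /L2norm Lpnorm2E.
have -> : (\int[rho]_(x in X) (cabs (synth phi c x) ^+ 2)%:E =
    \int[rho]_(x in X) (qform (M x) y)%:E)%E.
  apply: ae_eq_integral => //.
  - suff : measurable_fun X (EFin \o (fun x => cabs (synth phi c x) ^+ 2)) by [].
    apply/measurable_EFinP/measurable_cabs2; exact: cmeasurable_synth.
  - exact: measurable_int iq.
  - apply: filterS svd_ae => x H Xx; congr EFin.
    by rewrite H// qform_frame_mx.
have /fineK <- : (\int[rho]_(x in X) (qform (M x) y)%:E)%E \is a fin_num.
  exact: integrable_fin_num iq.
rewrite [fine (\int[rho]_(x in X) _)]Iq poweR_EFin/= powR12_sqrt//.
by apply: sumr_ge0 => i _; rewrite mulr_ge0 ?sqr_ge0.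
Qed.

Lemma L2norm_synth_qform c : L2norm X rho (synth phi c) = Num.sqrt (qform
  (\sum_i sigma i ^+ 2 *: frame_mx (fun=> 1) (fun l => conjc (v i l ord0)))
  (real_coords (fun l => c l ord0))).
Proof.
rewrite L2norm_synth qform_sum; congr Num.sqrt; apply: eq_bigr => i _.
rewrite qformZ qform_frame_mx; congr (_ * cabs _ ^+ 2); apply: eq_bigr => l _.
by rewrite sqrtr1 mul1r.
Qed.

(** Otherwise every [sigma_i] is below [eps], hence so is the operator norm,
    by Bessel's inequality; the case of an empty spectrum is included. *)
Lemma n_eps_ge_half : (eps%:E <= opnorm X rho phi)%E -> 1 / 2 <= N.
Proof.
move=> epsT; rewrite leNgt; apply/negP => N2.
have sig i : sigma i ^+ 2 < eps ^+ 2.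
  have : ratio i < 1 / 2.
    apply: le_lt_trans N2; rewrite n_epsE (bigD1 i)//= lerDl.
    by apply: sumr_ge0 => j _.
  by rewrite ltr_pdivrMr//; lra.
have [s s0 [seps sle]] : exists2 s, 0 <= s & s < eps /\ forall i, sigma i <= s.
  case: (posnP r) => [r0|r0].
    exists 0 => //; split=> // i; have := ltn_ord i; by rewrite {2}r0.
  exists (sigma (Ordinal r0)); first exact: ltW.
  split; last by move=> i; case: svd => -[_ dec] _ _ _; exact: dec.
  by rewrite -(@ltr_pXn2r _ 2)// nnegrE ltW.
have : (opnorm X rho phi <= s%:E)%E.
  apply: ge_ereal_sup => _ [c /= c0 <-]; rewrite lee_fin.
  have c_ge0 : 0 <= l2norm c by exact: sqrtr_ge0.
  have [->|cn0] := eqVneq (l2norm c) 0; first by rewrite invr0 mulr0.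
  rewrite ler_pdivrMr ?lt_neqAle ?c_ge0 1?eq_sym ?cn0//.
  rewrite L2norm_synth -(@ler_pXn2r _ 2)// ?nnegrE ?sqrtr_ge0 ?mulr_ge0//.
  rewrite sqr_sqrtr; last by apply: sumr_ge0 => i _; rewrite mulr_ge0 ?sqr_ge0.
  rewrite exprMn; apply: le_trans (ler_wpM2l (sqr_ge0 s) (bessel c vo)).
  rewrite mulr_sumr; apply: ler_sum => i _; rewrite ler_wpM2r ?sqr_ge0//.
  by rewrite lerXn2r// ?nnegrE// ltW.
by move=> /(le_trans epsT); rewrite lee_fin leNgt seps.
Qed.

Hypothesis k_gt0 : ae_on X rho (fun x => 0 < k x).
Hypothesis N_ge_half : 1 / 2 <= N.
Variables (delta : R) (delta0 : 0 < delta) (delta1 : delta < 1).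

Lemma ratio_gt1 : 1 < 8 * N / delta.
Proof.
by rewrite ltr_pdivlMr//; have := N_ge_half; have := delta1; lra.
Qed.

Section weight.
Variables (w : T -> R) (w_weight : is_weight X rho w) (K : R).
Hypothesis wk_le : ae_on X rho (fun x => w x * k x <= K).

Let M x := frame_mx ratio (u^~ x).

(** All almost sure hypotheses hold off one measurable null set. *)
Lemma exceptional_set : exists Z, [/\ measurable Z, rho Z = 0%E &
  forall x, X x -> ~ Z x -> [/\ 0 < k x, 0 < w x, w x * k x <= K & forall c,
    synth phi c x = \sum_(i < r) ((Num.sqrt (ratio i))%:C)%C * coef c i * u i x]].
Proof.
have w0 : {ae rho, forall x, X x -> 0 < w x} by case: w_weight.
have k0 : {ae rho, forall x, X x -> 0 < k x} by exact: k_gt0.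
have wk : {ae rho, forall x, X x -> w x * k x <= K} by exact: wk_le.
have : {ae rho, forall x, X x -> [/\ 0 < k x, 0 < w x, w x * k x <= K & forall c,
    synth phi c x = \sum_(i < r) ((Num.sqrt (ratio i))%:C)%C * coef c i * u i x]}.
  apply: filterS3 k0 w0 (filterI wk svd_ae) => x a b [c e] Xx.
  by split; [exact: a|exact: b|exact: c|exact: e].
move=> [Z [mZ Z0 HZ]]; exists Z; split=> // x Xx nZ.
by apply: contrapT => H; apply: nZ; apply: HZ => /(_ Xx).
Qed.

Lemma measurable_frame a b : measurable_fun X (fun x => M x a b).
Proof. exact/measurable_EFinP/measurable_int/(integrable_frame mX ratio u2). Qed.

(** Off the exceptional set the matrices satisfy the hypotheses of the
    Bernstein inequality everywhere, after being set to 0 on that set; the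
    samples avoid it almost surely because their law is dominated by [rho]. *)
Lemma stability_at_bound m : (8 * K + 4 / 3) * ln (8 * N / delta) <= m%:R ->
  stable_whp X rho phi eps delta w m.
Proof.
move=> mK dO Omega P x [xX law ind].
have mw : measurable_fun X w by case: w_weight.
have mstab := measurable_stability_event eps mX mw mphi xX L2norm_synth_qform.
split=> //.
have [Z [mZ Z0 HZ]] := exceptional_set.
pose G := X `\` Z.
have mG : measurable G by exact: measurableD.
have rhoG : rho G = 1%E.
  have XZ0 : rho (X `&` Z) = 0%E.
    apply/eqP; rewrite -measure_le0 -Z0; apply: le_measure; rewrite ?inE.
    - exact: measurableI.
    - exact: mZ.
    - exact: subIsetr.
  have X1 : (rho X < +oo)%E by rewrite rhoX ltry.
  have -> : rho G = (rho X - rho (X `&` Z))%E by exact: measureD.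
  by rewrite rhoX XZ0 sube0.
have GP t : G t -> [/\ 0 < k t, 0 < w t & w t * k t <= K].
  by move=> [Xt Zt]; have [] := HZ _ Xt Zt.
have [t0 Gt0] : exists t, G t.
  apply: contrapT => H; have G0 : G = set0.
    by apply/seteqP; split=> // t Gt; case: H; exists t.
  by move: rhoG; rewrite G0 measure0 => /eqP; rewrite eqe eq_sym oner_eq0.
have K0 : 0 < K.
  by have [a b] := GP _ Gt0; apply: lt_le_trans; exact: mulr_gt0.
pose A t : 'M[R]_(r + r) := if t \in G then w t *: M t else 0.
have kE t : k t = weight_sum ratio (u^~ t) by [].
have bA : bmeas_mx A.
  move=> a b; split.
    have -> : (fun t => A t a b) = (fun t => w t * M t a b) \_ G.
      apply/funext => t; rewrite patchE /A; case: ifP => _; last by rewrite mxE.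
      by rewrite mxE.
    apply: (measurable_restrictT _ mG).1; apply: measurable_funM.
      by apply: measurable_funS mw => // t [].
    by apply: measurable_funS (measurable_frame a b) => // t [].
  exists (2 * K) => t; rewrite /A; case: ifPn => [|_]; last first.
    by rewrite mxE normr0 mulr_ge0// ltW.
  rewrite inE => /GP[kt wt wkt]; rewrite mxE normrM (gtr0_norm wt).
  apply: le_trans (ler_wpM2l (ltW wt) (frame_mx_entry ratio0 _ a b)) _.
  by rewrite mulrCA -kE ler_pM2l.
have sA t : sym (A t).
  rewrite /A; case: ifP => _; last by rewrite /sym trmx0.
  exact/symZ/sym_frame_mx.
have pA t : psd (A t).
  rewrite /A; case: ifPn => [|_]; last by move=> y; rewrite qform0.
  by rewrite inE => /GP[_ wt _]; apply: psdZ; [exact: ltW|exact: psd_frame_mx].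
have pKA t : psd (K *: A t - A t ^+ 2).
  rewrite /A; case: ifPn => [|_]; last first.
    by rewrite expr0n/= scaler0 subr0 => y; rewrite qform0.
  rewrite inE => /GP[kt wt wkt].
  have -> : (w t *: M t) ^+ 2 = (w t * (w t * k t)) *: M t.
    rewrite expr2 -scaleMl -scaleMr scalerA -(expr2 (M t)) /M frame_mx_sqr//.
    by rewrite scalerA -kE mulrA.
  rewrite scalerA -scalerBl; apply: psdZ; last exact: psd_frame_mx.
  by rewrite [K * _]mulrC -mulrBr mulr_ge0 ?subr_ge0// ltW.
have dd01 a : 0 <= ratio_row ratio 0 a <= 1.
  rewrite mxE; case: fintype.split => i; rewrite mxE ratio0 ratio1//.
have EA j : mean_mx P (fun om => A (x j om)) = diag_mx (ratio_row ratio).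
  apply/matrixP => a b; rewrite mxE.
  rewrite (mean_sampling mX w_weight (law j) (f := fun t => A t a b)); last exact: bA.
  rewrite -(Rintegral_frame mX u2 uo ratio0) /Rintegral; congr fine.
  have mV := measurable_funV mw.
  apply: ae_eq_integral => //.
  - suff : measurable_fun X (EFin \o (fun t => A t a b * (w t)^-1)) by [].
    apply/measurable_EFinP/measurable_funM => //.
    by apply: measurable_funTS; case: (bA a b).
  - exact: measurable_int (integrable_frame mX ratio u2 a b).
  - exists Z; split=> // t /= H; apply: contrapT => Zt; apply: H => Xt.
    have Gt : G t by [].
    have [_ wt _] := GP _ Gt.
    by congr EFin; rewrite /A mem_set// mxE mulrAC mulfV ?mul1r// gt_eqF.
have trD : \tr (diag_mx (ratio_row ratio)) = 2 * N by rewrite tr_ratio_row n_epsE.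
have dD : delta <= \tr (diag_mx (ratio_row ratio)).
  by rewrite trD; have := N_ge_half; have := delta1; lra.
have mK' : (8 * K + 4 / 3) * ln (4 * \tr (diag_mx (ratio_row ratio)) / delta) <= m%:R.
  by rewrite trD mulrA (_ : 4 * 2 = 8 :> R)//; lra.
have [E [mE PE HE]] :=
  matrix_bernstein_lower ind bA sA pA pKA K0 dd01 EA delta0 dD mK'.
pose B := \big[setU/set0]_(j < m) (x j @^-1` Z).
have mxZ j : measurable (x j @^-1` Z).
  by rewrite -[X in measurable X]setTI; exact: measurable_funP.
have xZ j : P (x j @^-1` Z) = 0%E.
  have /null_content_dominatesP := sampling_dominated mX w_weight (law j).
  by apply.
have [mB PB] : measurable B /\ P B = 0%E.
  rewrite /B; elim/big_ind: _ => [|A1 A2 [mA1 A10] [mA2 A20]|j _].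
  - by split; [exact: measurable0|exact: measure0].
  - by split; [exact: measurableU|rewrite measureU0].
  - by split; [exact: mxZ|exact: xZ].
have PEB : (P (E `|` B) <= delta%:E)%E by rewrite measureU0.
suff sub : ~` (E `|` B) `<=` stability_event X rho phi eps w x.
  have mEB : measurable (E `|` B) by exact: measurableU.
  apply: (@le_trans _ _ (P (~` (E `|` B)))).
    by rewrite probability_setC// EFinB leeB.
  by apply: le_measure; rewrite ?inE//; exact: measurableC.
move=> om /not_orP[nE nB] c.
have Gx j : ~ Z (x j om).
  by move=> Zx; apply: nB; rewrite /B (bigD1 j)//=; left.
have mj (j : 'I_m) : 0 < m%:R :> R.
  by rewrite ltr0n (leq_ltn_trans (leq0n _) (ltn_ord j)).
have eT : (L2norm X rho (synth phi c)) ^+ 2 =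
    \sum_i sigma i ^+ 2 * cabs (alpha c i) ^+ 2.
  rewrite L2norm_synth sqr_sqrtr//.
  by apply: sumr_ge0 => i _; rewrite mulr_ge0 ?sqr_ge0.
apply: half_sum_le.
- by rewrite L2norm_synth sqrtr_ge0.
- by rewrite mulr_ge0 ?sqrtr_ge0// ltW.
- exact: sqrtr_ge0.
have := HE _ nE (real_coords (coef c)).
rewrite qform_D_coef -eT => H.
have eM : qform (\sum_(i < m) A (x i om)) (real_coords (coef c)) =
    m%:R * l2norm (sampling_op w (fun j => x j om) (synth phi c)) ^+ 2.
  rewrite qform_sum sampling_norm_sqr mulr_sumr; apply: eq_bigr => j _.
  have [_ wj _ ej] := HZ _ (xX j om) (Gx j).
  rewrite /A mem_set; last by split; [exact: xX|exact: Gx].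
  rewrite qformZ qform_frame_mx -ej sqr_sqrtr; last by rewrite divr_ge0// ltW.
  by field; rewrite gt_eqF// (mj j).
rewrite eM in H.
have m0 : 0 < m%:R :> R.
  apply: lt_le_trans mK; apply: mulr_gt0; last exact/ln_gt0/ratio_gt1.
  by rewrite addr_gt0 ?mulr_gt0 ?divr_gt0.
move: H; rewrite ler_pM2l//; apply: le_trans.
by rewrite lerB// ler_wpM2l// eT; apply: qform_1_coef.
Qed.

End weight.

Let rhoT : (0 < rho setT)%E.
Proof. by rewrite probability_setT lte01. Qed.

Lemma Linfty_ae (g : T -> R) (K : R) :
  Lpnorm X rho +oo g = K%:E -> ae_on X rho (fun x => g x <= K).
Proof.
rewrite /Lpnorm unlock/= rhoT => gK.
have := ess_sup_ge rho (abse \o ((EFin \o g) \_ X)); rewrite gK.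
rewrite /ae_on; apply: filterS => x + Xx.
by rewrite /= patchE mem_set//= lee_fin; apply: le_trans; exact: ler_norm.
Qed.

Lemma Linfty_cst (g : T -> R) (a : R) : 0 <= a ->
  ae_on X rho (fun x => g x = a) -> Lpnorm X rho +oo g = a%:E.
Proof.
move=> a0 ga; rewrite /Lpnorm unlock/= rhoT; apply: ess_sup_ae_cst => //.
have aeX : {ae rho, forall x, X x}.
  exists (~` X); split; [exact: measurableC| |by []].
  by rewrite probability_setC// rhoX subee.
have {}ga : {ae rho, forall x, X x -> g x = a} by exact: ga.
apply: filterS2 aeX ga => x Xx /(_ Xx) gxa.
by rewrite /= patchE mem_set//= gxa ger0_norm.
Qed.

Lemma stability_of_weight (w : T -> R) : is_weight X rho w -> forall m : nat,
  (m%:R%:E >= ((934 / 100)%:E * Lpnorm X rho +oo (fun x => (w x * k x)%R)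
               + (134 / 100)%:E) * (ln (8 * N / delta))%:E)%E ->
  stable_whp X rho phi eps delta w m.
Proof.
move=> ww m.
have L0 : 0 < ln (8 * N / delta) by exact/ln_gt0/ratio_gt1.
have := Lnorm_ge0 rho +oo ((EFin \o (fun x => w x * k x)) \_ X).
rewrite -/(Lpnorm X rho +oo (fun x => w x * k x)).
case E : (Lpnorm X rho +oo (fun x => w x * k x)) => [K| |] //.
  rewrite lee_fin => K0; rewrite -!EFinM lee_fin => mK.
  apply: (stability_at_bound ww (Linfty_ae E)); apply: le_trans mK.
  by rewrite ler_pM2r//; lra.
have c934 : (0 < (934 / 100)%:E :> \bar R)%E by rewrite lte_fin; lra.
move=> _; rewrite (gt0_muley c934) addye//.
by rewrite gt0_mulye ?lte_fin// leNgt ltry.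
Qed.

Let N0 : 0 < N. Proof. by have := N_ge_half; lra. Qed.

Let measurable_k : measurable_fun X k.
Proof. exact/measurable_EFinP/measurable_int/k_eps_integral.1. Qed.

Let k_ge0 x : 0 <= k x. Proof. by rewrite k_epsE weight_sum_ge0. Qed.

Lemma optimal_weight : is_weight X rho (fun x => N / k x).
Proof.
split.
- by apply: measurable_funM => //; exact: measurable_funV.
- have k0 : {ae rho, forall x, X x -> 0 < k x} by exact: k_gt0.
  by rewrite /ae_on; apply: filterS k0 => x H Xx; rewrite divr_gt0// H.
- rewrite /Lpnorm Lnorm1.
  transitivity (\int[rho]_(x in X) (N^-1 * k x)%:E)%E.
    rewrite [RHS]integral_mkcond; apply: eq_integral => x _; rewrite !patchE.
    case: ifP => _ /=; last by rewrite normr0.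
    by rewrite invfM invrK ger0_norm// mulr_ge0// invr_ge0 ltW.
  have ik := integrable_scale mX N^-1 k_eps_integral.1.
  rewrite -[LHS]fineK; last exact: integrable_fin_num ik.
  have -> : fine (\int[rho]_(x in X) (N^-1 * k x)%:E) = 1; last by [].
  rewrite [LHS](RintegralZl _ mX k_eps_integral.1).
  by rewrite -/N -[\int[rho]_(x in X) _]/N mulVf// gt_eqF.
Qed.

Lemma Linfty_optimal_weight : Lpnorm X rho +oo (fun x => N / k x * k x) = N%:E.
Proof.
apply: Linfty_cst; first exact: ltW.
have k0 : {ae rho, forall x, X x -> 0 < k x} by exact: k_gt0.
by rewrite /ae_on; apply: filterS k0 => x H Xx; rewrite divfK// gt_eqF// H.
Qed.

End stability.

Theorem theorem26 (R : realType) (d : nat) (X : set (d.-tuple R))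
    (mX : measurable X) (rho : probability (d.-tuple R) R)
    (rhoX : rho X = 1%E) (rho_nonatomic : nonatomic rho)
    (n : nat) (phi : 'I_n -> d.-tuple R -> R[i])
    (phi_Linfty : forall i, in_Linfty X rho (phi i))
    (nhat : nat) (sigma : 'I_nhat -> R) (u : 'I_nhat -> d.-tuple R -> R[i])
    (v : 'I_nhat -> 'cV[R[i]]_n) (svd : is_svd X rho phi sigma u v)
    (eps delta : R) (delta0 : 0 < delta) (delta1 : delta < 1)
    (eps0 : 0 < eps) (eps_le : (eps%:E <= opnorm X rho phi)%E)
    (k_gt0 : ae_on X rho (fun x => 0 < k_eps sigma u eps x)) :
  let k := k_eps sigma u eps in
  let N := n_eps X rho sigma u eps in
  [/\ N = \sum_(i < nhat) sigma i ^+ 2 / (sigma i ^+ 2 + eps ^+ 2),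
      forall w : d.-tuple R -> R, is_weight X rho w ->
        forall m : nat,
        (m%:R%:E >= ((934 / 100)%:E * Lpnorm X rho +oo (fun x => (w x * k x)%R)
                     + (134 / 100)%:E) * (ln (8 * N / delta))%:E)%E ->
        stable_whp X rho phi eps delta w m
    & let w := fun x => N / k x in
      [/\ is_weight X rho w,
          Lpnorm X rho +oo (fun x => w x * k x) = N%:E
        & forall m : nat,
          m%:R >= (934 / 100 * N + 134 / 100) * ln (8 * N / delta) ->
          stable_whp X rho phi eps delta w m]].
Proof.
move=> k N.
have N_half := n_eps_ge_half mX phi_Linfty svd eps0 eps_le.
have wopt := optimal_weight mX svd eps0 k_gt0 N_half.
have Lopt := Linfty_optimal_weight mX rhoX k_gt0 N_half.
have stable := stability_of_weight mX rhoX phi_Linfty svd eps0 k_gt0 N_half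
  delta0 delta1.
split; [exact: (n_epsE mX svd eps)|exact: stable|split=> //] => m mN.
by apply: stable => //; rewrite Lopt -!EFinM lee_fin.
Qed.
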